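(* Let $p$ be a prime, let $n$ be a positive integer, and let $G$ be (isomorphic to) a subgroup of one of the groups $$\mathbb{Z}_2^5,\quad \mathbb{Z}_p^3,\quad \mathbb{Z}_{p^n}\times\mathbb{Z}_p,\quad \mathbb{Z}_4\times\mathbb{Z}_2^2.$$ If $m$ is a square-free positive integer with $\gcd(|G|,m)=1$, then the group $G\times\mathbb{Z}_m$ has the PT property.
   Context: $\mathbb{Z}_N$ denotes the cyclic group of order $N$. For a finite abelian group $G$ (written additively), a pair $(\Omega,T)$ of subsets of $G$ is a tiling pair if every $g\in G$ can be written uniquely as $g=\omega+t$ with $\omega\in\Omega$, $t\in T$. A nonempty subset $A\subset G$ is periodic if there is a nonzero $g\in G$ with $A+g=A$. $G$ has the periodic tiling property (PT property) if for every tiling pair $(\Omega,T)$ of $G$, either $\Omega$ is periodic, or there is a periodic set $T'\subset G$ such that $(\Omega,T')$ is also a tiling pair. Convention: the trivial group is regarded as having the PT property. *)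

(* Defs.v *)
From mathcomp Require Import all_boot all_order all_algebra all_fingroup.

Set Implicit Arguments.
Unset Strict Implicit.
Unset Printing Implicit Defensive.

Local Open Scope group_scope.

(* Finite abelian groups are treated as groups G : {group gT}, so their law is
   written multiplicatively: w * t is the sum w + t, and A :* g the translate
   A + g.  On 'Z_N and 'rV['Z_N]_k the group law is the addition. *)

Definition tiling_pair (gT : finGroupType) (G Om T : {set gT}) : Prop :=
  [/\ Om \subset G, T \subset G &
      forall g, g \in G ->
        exists! x : gT * gT, [/\ x.1 \in Om, x.2 \in T & g = x.1 * x.2]].

Definition periodic (gT : finGroupType) (G A : {set gT}) : Prop :=
  A != set0 /\ exists2 g, g \in G^# & A :* g = A.

(* The trivial group has the property by convention: its only tiling pair
   (1, 1) has no periodic member. *)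
Definition PT_property (gT : finGroupType) (G : {set gT}) : Prop :=
  G = 1 \/
  forall Om T : {set gT}, tiling_pair G Om T ->
    periodic G Om \/
    exists2 T' : {set gT}, periodic G T' & tiling_pair G Om T'.

Definition isog_to_subgroup (gT : finGroupType) (G : {set gT})
    (hT : finGroupType) : Prop :=
  exists H : {group hT}, G \isog H.

Definition square_free (m : nat) : Prop :=
  forall d : nat, (d ^ 2 %| m)%N -> d = 1%N.

(* Main.v *)
Require Import Defs.
From mathcomp Require Import all_boot all_order all_algebra all_fingroup.
From mathcomp Require Import all_solvable all_field all_character.

(* Let (Om, T) be a tiling of A = G x Z_m.  By Tijdeman's theorem Om may be
   replaced by its set of k-th powers when k is prime to |Om|.  If a prime q
   divides |A| but not |Om|, then {t : t ^ q in T} is a complement of Om, and it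
   is invariant under the elements of order q.  Otherwise m is prime to |T|, and
   T may be replaced by its set of m-th powers, which lies in G; the slices of Om
   are then complements of T in G.  So it suffices that for each T in G either
   all its complements have a common period, or a single periodic set is a
   complement of all of them at once.

   The last point rests on characters: if chi is nontrivial and the sum of chi
   over T is nonzero, then the sum of every power chi ^ j with j prime to p
   vanishes over every complement of T, which makes all complements
   equidistributed between the cosets of ker chi inside each coset of
   ker (chi ^ p).  For Z_p^k this makes ker chi, or the intersection of two such
   kernels, a common complement; for Z_(p^n) x Z_p a common complement is built
   down the chain of the kernels of chi ^ (p ^ i). *)

Set Implicit Arguments.
Unset Strict Implicit.
Unset Printing Implicit Defensive.

Import Order.TTheory GRing.Theory FinRing.Theory Num.Theory.
Local Open Scope group_scope.

(** * Tilings of a finite group and Tijdeman's theorem *)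

Definition tile (gT : finGroupType) (A Om T : {set gT}) : bool :=
  [&& Om \subset A, T \subset A, Om * T == A & (#|Om| * #|T| == #|A|)%N].

Section Tilings.

Variables (gT : finGroupType) (A : {group gT}).
Implicit Types (Om T : {set gT}) (x y g : gT).

Lemma tile_inj Om T : tile A Om T ->
  {in setX Om T &, injective (fun x : gT * gT => x.1 * x.2)}.
Proof.
case/and4P=> _ _ /eqP defA /eqP cardA; apply/imset_injP.
rewrite cardsX cardA -defA; apply/eqP; apply: eq_card => g.
apply/imsetP/mulsgP => [[[w t] /setXP[/= Ow Tt] ->] | [w t Ow Tt ->]].
  by exists w t.
by exists (w, t); rewrite ?inE ?Ow.
Qed.

Lemma tile_uniq Om T w w' t t' : tile A Om T -> w \in Om -> w' \in Om ->
  t \in T -> t' \in T -> w * t = w' * t' -> w = w' /\ t = t'.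
Proof.
move=> /tile_inj inj Ow Ow' Tt Tt' E.
have := inj (w, t) (w', t'); rewrite !inE /= Ow Ow' Tt Tt'.
by case/(_ isT isT E).
Qed.

Lemma tile_mem Om T g : tile A Om T -> g \in A ->
  exists w t, [/\ w \in Om, t \in T & g = w * t].
Proof.
by case/and4P=> _ _ /eqP<- _ /mulsgP[w t Ow Tt ->]; exists w, t.
Qed.

Lemma tile_sub Om T : tile A Om T -> Om \subset A /\ T \subset A.
Proof. by case/and4P. Qed.

Lemma tile_card Om T : tile A Om T -> (#|Om| * #|T|)%N = #|A|.
Proof. by case/and4P=> _ _ _ /eqP. Qed.

Lemma tile_card_gt0 Om T : tile A Om T -> (0 < #|Om|) && (0 < #|T|).
Proof. by move/tile_card=> E; rewrite -muln_gt0 E cardG_gt0. Qed.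

Lemma mulg_imset (B C : {set gT}) :
  B * C = [set x.1 * x.2 | x in setX B C].
Proof.
apply/setP=> g; apply/mulsgP/imsetP => [[w t Ow Tt ->] | [[w t]]].
  by exists (w, t); rewrite ?inE ?Ow.
by case/setXP=> Ow Tt ->; exists w t.
Qed.

Lemma tile_surj Om T : Om \subset A -> T \subset A -> A \subset Om * T ->
  (#|Om| * #|T| <= #|A|)%N -> tile A Om T.
Proof.
move=> sOA sTA sA leA; rewrite /tile sOA sTA /= eqEsubset mul_subG //= sA /=.
by rewrite eqn_leq leA (leq_trans (subset_leq_card sA)) // mulg_imset
  -cardsX leq_imset_card.
Qed.

Lemma tile_of_inj Om T : Om \subset A -> T \subset A ->
    (#|Om| * #|T|)%N = #|A| ->
    (forall w w' t t', w \in Om -> w' \in Om -> t \in T -> t' \in T ->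
       w * t = w' * t' -> t = t') ->
  tile A Om T.
Proof.
move=> sOA sTA cardA inj; rewrite /tile sOA sTA cardA eqxx andbT /=.
rewrite eqEcard mul_subG //= -cardA -cardsX mulg_imset card_in_imset //.
case=> w t [w' t'] /setXP[/= Ow Tt] /setXP[/= Ow' Tt'] E.
have Et := inj _ _ _ _ Ow Ow' Tt Tt' E.
by move: E; rewrite Et => /mulIg->.
Qed.

(** A surjection between finite sets of equal size is injective, so covering [A] together with the
    cardinality identity amounts to unique factorization, and being a tiling becomes decidable. *)
Lemma tiling_pairP Om T : tiling_pair A Om T <-> tile A Om T.
Proof.
split=> [[sOA sTA tl] | tOT].
  have inj: {in setX Om T &, injective (fun x : gT * gT => x.1 * x.2)}.
    move=> [w t] [w' t'] /setXP[/= Ow Tt] /setXP[/= Ow' Tt'] /= E.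
    have Awt: w * t \in A by rewrite groupM ?(subsetP sOA w) ?(subsetP sTA t).
    have [x [_ uniq_x]] := tl _ Awt.
    by rewrite -(uniq_x (w, t)) // -(uniq_x (w', t')).
  apply: tile_surj => //.
    apply/subsetP=> g /tl[[w t] [[/= Ow Tt ->] _]].
    by rewrite mem_mulg.
  rewrite -cardsX -(card_in_imset inj) subset_leq_card // -mulg_imset.
  by rewrite mul_subG.
have [sOA sTA] := tile_sub tOT; split=> // g Ag.
have [w [t [Ow Tt Eg]]] := tile_mem tOT Ag.
exists (w, t); split=> //= [[w' t'] /= [Ow' Tt' Eg']].
by have [|-> ->] := tile_uniq tOT Ow Ow' Tt Tt'; rewrite -?Eg.
Qed.

Lemma tile_count Om T g : tile A Om T -> g \in A ->
  #|[set w in Om | w^-1 * g \in T]| = 1%N.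
Proof.
move=> tOT Ag; have [w [t [Ow Tt Eg]]] := tile_mem tOT Ag.
apply/eqP/cards1P; exists w; apply/setP=> w'; rewrite !inE.
apply/andP/eqP => [[Ow' Tt'] | ->]; last by rewrite Eg mulKg.
by have [|-> //] := tile_uniq tOT Ow' Ow Tt' Tt; rewrite mulKVg.
Qed.

Lemma tile_of_count Om T : Om \subset A -> T \subset A ->
    (forall g, g \in A -> #|[set w in Om | w^-1 * g \in T]| = 1%N) ->
  tile A Om T.
Proof.
move=> sOA sTA cnt; apply/tiling_pairP; split=> // g Ag.
have /eqP/cards1P[w Ew] := cnt g Ag.
have: w \in [set w] by rewrite set11.
rewrite -Ew inE => /andP[Ow Tw].
exists (w, w^-1 * g); split=> /= [|[w' t] /= [Ow' Tt Eg]].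
  by rewrite mulKVg.
suffices ->: w = w' by rewrite Eg mulKg.
by apply/esym/set1P; rewrite -Ew inE Ow' Eg mulKg.
Qed.

Hypothesis abelA : abelian A.

Lemma memAC x y : x \in A -> y \in A -> x * y = y * x.
Proof. by move=> Ax Ay; apply: (centsP abelA). Qed.

Lemma tileC Om T : tile A Om T = tile A T Om.
Proof.
rewrite /tile mulnC andbCA; have [sTA|] := boolP (T \subset A) => //=.
have [sOA|] := boolP (Om \subset A) => //=.
by rewrite (centC (subset_trans sOA (subset_trans abelA (centS sTA)))).
Qed.

Lemma frobenius_mx q n' (rG : mx_representation 'F_q A n'.+1) T :
  prime q -> T \subset A ->
  ((\sum_(t in T) rG t) ^+ q = \sum_(t in T) rG (t ^+ q)%g)%R.
Proof.
move=> q_pr sTA.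
have chq: q \in [pchar 'M['F_q]_n'.+1]%R by rewrite pchar_lalg pchar_Fp.
have comm_r (s t : gT) : s \in A -> t \in A -> GRing.comm (rG s) (rG t).
  move=> As At; rewrite /GRing.comm -[(rG s * rG t)%R]/(rG s *m rG t)%R.
  by rewrite -[(rG t * rG s)%R]/(rG t *m rG s)%R -!repr_mxM // memAC.
(* Frobenius is additive on commuting matrices only, so commutation with all of [A] is carried along
   the induction on the sum. *)
pose K (X : 'M['F_q]_n'.+1) Y := (forall s, s \in A -> GRing.comm (rG s) X) /\
  (X ^+ q = Y)%R.
suffices []: K (\sum_(t in T) rG t)%R (\sum_(t in T) rG (t ^+ q)%g)%R by [].
have: all (mem A) (enum T).
  by apply/allP=> t; rewrite mem_enum => /(subsetP sTA).
rewrite -!big_enum /=; elim: (enum T) => [_ | t e IHe /=].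
  by rewrite !big_nil; split=> [s _|]; [apply: commr0 | rewrite expr0n -[q]prednK ?prime_gt0].
case/andP=> At /IHe[Hc Hq]; rewrite !big_cons; split=> [s As|].
  by apply: commrD; [apply: comm_r | apply: Hc].
have := pFrobenius_autD_comm chq (Hc t At).
rewrite !pFrobenius_autE => ->; by rewrite Hq repr_mxX.
Qed.

(** With [S] and [W] the images of [Om] and [T] in the group algebra, [S W] is the sum [Ga] over
    [A], and [S Ga = |Om| Ga]. The left side is [S ^ q W] by Frobenius, that is [S ^ (q - 1) Ga]. *)
Lemma tijdeman_mx q n (rG : mx_representation 'F_q A n) Om T :
    prime q -> tile A Om T ->
  (\sum_(w in Om) \sum_(t in T) rG (w ^+ q * t)%g =
   (#|Om|%:R ^+ q.-1) *: \sum_(g in A) rG g)%R.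
Proof.
move=> q_pr tOT; case: n rG => [|n'] rG; first by rewrite !flatmx0.
have [sOA sTA] := tile_sub tOT.
pose S := (\sum_(w in Om) rG w)%R; pose W := (\sum_(t in T) rG t)%R.
pose Ga := (\sum_(g in A) rG g)%R.
have SW: (S * W = Ga)%R.
  case/and4P: (tOT) => _ _ /eqP defA _.
  have -> : Ga = (\sum_(g in (Om * T)%g) rG g)%R by apply: eq_bigl => g; rewrite defA.
  transitivity (\sum_(w in Om) \sum_(t in T) rG (w * t)%g)%R; last first.
    rewrite mulg_imset big_imset; last exact: tile_inj tOT.
    by rewrite pair_big; apply: eq_bigl => -[w t]; rewrite inE.
  rewrite mulr_suml.
  apply: eq_bigr => w Ow; rewrite mulr_sumr; apply: eq_bigr => t Tt.
  by rewrite repr_mxM ?(subsetP sOA w) ?(subsetP sTA t).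
have SGa: (S * Ga = #|Om|%:R *: Ga)%R.
  rewrite mulr_suml (eq_bigr (fun=> Ga)) => [|w Ow].
    by rewrite sumr_const scaler_nat.
  have Aw := subsetP sOA w Ow.
  rewrite /Ga mulr_sumr [RHS](reindex_inj (mulgI w)) /=.
  apply: eq_big => [g|g Ag]; first by rewrite groupMl.
  by rewrite repr_mxM.
transitivity (S ^+ q * W)%R.
  rewrite frobenius_mx // mulr_suml; apply: eq_bigr => w Ow.
  rewrite mulr_sumr; apply: eq_bigr => t Tt.
  by rewrite repr_mxM ?groupX ?(subsetP sOA w) ?(subsetP sTA t).
have -> : (S ^+ q = S ^+ q.-1 * S)%R by rewrite -exprSr prednK ?prime_gt0.
rewrite -mulrA SW -/Ga.
elim: q.-1 => [|k IHk]; first by rewrite !expr0 mul1r scale1r.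
by rewrite exprSr -mulrA SGa -scalerAr IHk scalerA -exprS.
Qed.

(** In the regular representation the entry at [(1, g)] reads off the coefficient of [g]. A [g]
    outside the product would have coefficient 0 on one side and [|Om| ^ (q - 1)], nonzero in
    ['F_q], on the other. *)
Lemma tijdeman_prime q Om T : prime q -> ~~ (q %| #|Om|) -> tile A Om T ->
  tile A [set w ^+ q | w in Om] T.
Proof.
move=> q_pr qOm tOT; have [sOA sTA] := tile_sub tOT.
have sqA: [set w ^+ q | w in Om] \subset A.
  by apply/subsetP=> _ /imsetP[w Ow ->]; rewrite groupX ?(subsetP sOA).
apply: tile_surj => //; last first.
  by rewrite -(tile_card tOT) leq_mul2r leq_imset_card orbT.
apply/subsetP=> g Ag; apply/negPn/negP=> gN.
have /matrixP/(_ (gring_index A 1) (gring_index A g)) :=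
  tijdeman_mx (regular_repr 'F_q A) q_pr tOT.
have rE h : h \in A ->
  (regular_repr 'F_q A h (gring_index A 1) (gring_index A g) = (g == h)%:R)%R.
  move=> Ah; rewrite !mxE gring_indexK ?group1 // mul1g eqxx /=.
  by rewrite (can_in_eq gring_indexK).
rewrite summxE big1 => [|w Ow]; last first.
  rewrite summxE big1 // => t Tt.
  have [Aw At] := (subsetP sOA w Ow, subsetP sTA t Tt).
  rewrite rE ?groupM ?groupX //; case: eqP => // Eg; case/negP: gN.
  by rewrite Eg; apply: mem_mulg => //; apply/imsetP; exists w.
rewrite mxE summxE (bigD1 g) //= rE // eqxx big1 => [|h /andP[Ah /negPf ne]].
  rewrite addr0 mulr1 => /esym/eqP; rewrite expf_eq0 => /andP[_].
  by rewrite -(dvdn_pcharf (pchar_Fp q_pr)) (negPf qOm).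
by rewrite rE // eq_sym ne.
Qed.

Lemma tile_card_eq Om T T' : tile A Om T -> tile A T' T -> #|T'| = #|Om|.
Proof.
move=> t1 t2; have /andP[_ T0] := tile_card_gt0 t1.
by apply/eqP; rewrite -(eqn_pmul2r T0) (tile_card t1) (tile_card t2).
Qed.

Theorem tijdeman k Om T : coprime #|Om| k -> tile A Om T ->
  tile A [set w ^+ k | w in Om] T.
Proof.
elim/ltn_ind: k Om => k IHk Om coOk tOT; have [sOA _] := tile_sub tOT.
have [k1 | k1] := leqP k 1.
  (* The exponent 0 is coprime only to [#|Om| = 1]; then [T = A], with complement [1]. *)
  case: k k1 coOk {IHk} => [|[|//]] _ => [|_]; last first.
    have -> // : [set w ^+ 1 | w in Om] = Om.
    by rewrite (eq_imset _ (@expg1 _)) imset_id.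
  rewrite /coprime gcdn0 => /cards1P[w defO].
  move: tOT; rewrite defO imset_set1 expg0 => tOT.
  have [sO sT] := tile_sub tOT; have Aw : w \in A by rewrite -sub1set.
  have cT : #|T| = #|A| by have := tile_card tOT; rewrite cards1 mul1n.
  have -> : T = A by apply/eqP; rewrite eqEcard sT cT leqnn.
  by rewrite /tile sub1G subxx mul1g eqxx cards1 mul1n eqxx.
pose q := pdiv k; have q_pr : prime q by apply: pdiv_prime.
have defk: k = (q * (k %/ q))%N by rewrite mulnC divnK // pdiv_dvd.
have k'k: k %/ q < k by rewrite ltn_Pdiv ?prime_gt1 // ltnW.
move: coOk; rewrite {1}defk coprimeMr => /andP[coOq coOk'].
have tq: tile A [set w ^+ q | w in Om] T.
  by apply: tijdeman_prime => //; rewrite -prime_coprime // coprime_sym.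
have := IHk _ k'k [set w ^+ q | w in Om].
rewrite (tile_card_eq tOT tq) => /(_ coOk' tq); rewrite -imset_comp.
congr (tile A _ T); apply: eq_imset => w /=; by rewrite [in RHS]defk expgM.
Qed.

(** The [q]-th powers of [Om] still tile with [T], so factoring [g ^+ q] shows that exactly one [w]
    in [Om] has [w^-1 * g] in the preimage [T'] of [T] under [q]-th powers. Elements of order [q]
    are periods of [T']. *)
Lemma periodic_complement q Om T : prime q -> q %| #|A| -> ~~ (q %| #|Om|) ->
  tile A Om T -> exists2 T', periodic A T' & tile A Om T'.
Proof.
move=> q_pr qA qO tOT; have [sOA sTA] := tile_sub tOT.
have tq := tijdeman_prime q_pr qO tOT.
have injq: {in Om &, injective (fun w => w ^+ q)}.
  by apply/imset_injP; rewrite (tile_card_eq tOT tq).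
pose T' := [set t in A | t ^+ q \in T].
have memO w : w \in Om -> w \in A by apply: subsetP.
have tl: tile A Om T'.
  apply: tile_of_count => // [|g Ag]; first by apply/subsetP=> t /setIdP[].
  have /eqP/cards1P[v Ev] := tile_count tq (groupX q Ag).
  have: v \in [set v] by rewrite set11.
  rewrite -Ev inE => /andP[/imsetP[w Ow defv] Tv].
  apply/eqP/cards1P; exists w; apply/setP=> w'; rewrite !inE.
  apply/andP/eqP => [[Ow'] /andP[Ag' Tw'] | ->].
    apply: injq => //; rewrite -defv; apply/set1P; rewrite -Ev inE.
    apply/andP; split; first by apply/imsetP; exists w'.
    by move: Tw'; rewrite expgMn ?expgVn //; apply: memAC; rewrite ?groupV ?(memO w').
  rewrite Ow groupM ?groupV ?(memO w) //= expgMn; last first.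
    by apply: memAC; rewrite ?groupV ?(memO w).
  by rewrite expgVn -defv.
exists T' => //; split.
  by have /andP[_] := tile_card_gt0 tl; rewrite card_gt0.
have [h Ah oh] := Cauchy q_pr qA; exists h.
  by rewrite !inE Ah andbT -order_gt1 oh prime_gt1.
have hq: h ^+ q = 1 by rewrite -oh expg_order.
apply/eqP; rewrite eqEcard card_rcoset leqnn andbT.
apply/subsetP=> _ /rcosetP[t /setIdP[At Tt] ->].
by rewrite inE groupM //= expgMn ?hq ?mulg1 //; apply: memAC.
Qed.

End Tilings.

(** * Characters *)

Section Characters.

Variables (gT : finGroupType) (A : {group gT}).
Implicit Types (Om T : {set gT}) (x y g : gT) (f : gT -> algC).

(** Bare functions constrained on [A] only, so that powers and products of irreducible characters
    stay of the same kind. *)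
Definition lchar f :=
  f 1 = 1%R /\ {in A &, {morph f : x y / x * y >-> (x * y)%R}}.

Lemma lcharX f x n : lchar f -> x \in A -> f (x ^+ n) = (f x ^+ n)%R.
Proof.
case=> f1 fM Ax; elim: n => [|n IHn]; first by rewrite expg0 expr0.
by rewrite expgS exprS fM ?groupX // IHn.
Qed.

Lemma lchar_order f x : lchar f -> x \in A -> (f x ^+ #|A|)%R = 1%R.
Proof. by move=> lf Ax; rewrite -lcharX // expg_cardG //; case: lf. Qed.

Lemma lchar_neq0 f x : lchar f -> x \in A -> f x != 0%R.
Proof.
move=> lf Ax; apply/eqP=> fx0; have := lchar_order lf Ax.
by rewrite fx0 expr0n -[#|A|]prednK // => /eqP; rewrite eq_sym oner_eq0.
Qed.

Lemma lcharV f x : lchar f -> x \in A -> f x^-1 = (f x)^-1%R.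
Proof.
move=> lf Ax; case: (lf) => f1 fM.
have := fM x^-1 x; rewrite groupV mulVg f1 => /(_ Ax Ax) E.
by rewrite -[RHS]mul1r E mulfK // lchar_neq0.
Qed.

Lemma lchar_pow f n : lchar f -> lchar (fun x => f x ^+ n)%R.
Proof.
by case=> f1 fM; split=> [|x y Ax Ay]; rewrite ?f1 ?expr1n ?fM ?exprMn.
Qed.

Lemma lchar_mul f f' : lchar f -> lchar f' -> lchar (fun x => f x * f' x)%R.
Proof.
case=> f1 fM [f'1 f'M]; split=> [|x y Ax Ay]; first by rewrite f1 f'1 mulr1.
by rewrite fM // f'M // mulrACA.
Qed.

Lemma lchar_sum0 f x : lchar f -> x \in A -> f x != 1%R ->
  (\sum_(g in A) f g = 0)%R.
Proof.
case=> _ fM Ax fx1; apply/eqP; set s := (\sum_(g in A) _)%R.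
have: (s = f x * s)%R.
  rewrite mulr_sumr {1}/s (reindex_inj (mulgI x)) /=.
  by apply: eq_big => [g | g Ag]; rewrite ?groupMl // fM // -(groupMl _ Ax).
move/eqP; rewrite -{1}[s]mul1r -subr_eq0 -mulrBl mulf_eq0 subr_eq0.
by rewrite eq_sym (negPf fx1).
Qed.

Lemma tile_lchar f Om T : lchar f -> tile A Om T ->
  ((\sum_(w in Om) f w) * (\sum_(t in T) f t) = \sum_(g in A) f g)%R.
Proof.
move=> [_ fM] tOT; have [sOA sTA] := tile_sub tOT.
have -> : (\sum_(g in A) f g = \sum_(g in (Om * T)%g) f g)%R.
  by case/and4P: tOT => _ _ /eqP defA _; apply: eq_bigl => g; rewrite defA.
rewrite mulg_imset big_imset; last exact: tile_inj tOT.
rewrite big_distrlr pair_big /=; apply: eq_big => [[w t]|[w t] /= /andP[Ow Tt]].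
  by rewrite inE.
by rewrite fM // ?(subsetP sOA w) ?(subsetP sTA t).
Qed.

Definition chker f := [set x in A | f x == 1%R].

Lemma chker_group_set f : lchar f -> group_set (chker f).
Proof.
case=> f1 fM; apply/group_setP; split=> [|x y]; first by rewrite inE group1 f1 /=.
rewrite !inE => /andP[Ax /eqP fx] /andP[Ay /eqP fy].
by rewrite groupM // fM // fx fy mulr1 eqxx.
Qed.

Definition chker_group f (lf : lchar f) := Group (chker_group_set lf).

Lemma chker_sub f : chker f \subset A.
Proof. by apply/subsetP=> x /setIdP[]. Qed.

Lemma mem_chker f x : (x \in chker f) = (x \in A) && (f x == 1%R).
Proof. by rewrite inE. Qed.

Definition vanish p f T :=
  forall j, coprime j p -> (\sum_(t in T) f t ^+ j = 0)%R.

(** For [K] of index [p] in [K']: inside each coset of [K'], the points of [T] are spread evenly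
    over the cosets of [K]. *)
Definition uniform p T (K K' : {set gT}) :=
  forall g, g \in A -> (p * #|T :&: K :* g| = #|T :&: K' :* g|)%N.

Lemma sum_powers (z : algC) n : (z ^+ n = 1)%R ->
  (\sum_(0 <= j < n) z ^+ j = if z == 1 then n%:R else 0)%R.
Proof.
move=> zn; case: eqP => [->|/eqP z1].
  rewrite (eq_bigr (fun=> 1%R)) => [|i _]; last by rewrite expr1n.
  by rewrite big_mkord sumr_const card_ord.
apply/eqP; rewrite big_mkord -(inj_eq (mulfI (_ : z - 1 != 0)%R)) ?subr_eq0 //.
by rewrite -subrX1 zn subrr mulr0.
Qed.

Lemma sum_chker f T g : lchar f -> T \subset A -> g \in A ->
  (\sum_(t in T) (f (t * g^-1)%g == 1%R)%:R = #|T :&: chker f :* g|%:R :> algC)%R.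
Proof.
move=> lf sTA Ag; rewrite -sum1_card natr_sum (big_setID (chker f :* g)) /=.
rewrite [X in (_ + X)%R]big1 => [|t /setDP[Tt]]; last first.
  rewrite mem_rcoset mem_chker groupM ?groupV ?(subsetP sTA t) //=.
  by case: eqP.
rewrite addr0; apply: eq_bigr => t /setIP[_].
by rewrite mem_rcoset mem_chker => /andP[_ ->].
Qed.

Lemma sum_multiples p M (F : nat -> algC) : 0 < p ->
  (\sum_(0 <= j < M * p | (p %| j)%N) F j = \sum_(0 <= i < M) F (i * p)%N)%R.
Proof.
move=> p0; rewrite big_mkcond big_nat_mul; apply: eq_bigr => i _.
rewrite big_ltn ?ltn_pmul2r // dvdn_mull // big_nat big1; first exact: addr0.
move=> j /andP[lo hi]; case: ifP => // /dvdnP[k defj]; move: lo hi.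
by rewrite defj !ltn_pmul2r // => /leq_trans h /h; rewrite ltnn.
Qed.

(** Summing [f (t * g^-1) ^+ j] over all [j] below [M * p] detects [f = 1], and over the multiples
    of [p] it detects [f ^ p = 1]. The other exponents contribute nothing once summed over [T]; the
    normalizations [M * p] and [M] leave the factor [p]. *)
Lemma vanish_uniform p f T : prime p -> lchar f -> T \subset A ->
  vanish p f T -> uniform p T (chker f) (chker (fun x => f x ^+ p)%R).
Proof.
move=> p_pr lf sTA vT g Ag; have p0 := prime_gt0 p_pr.
have lfp := lchar_pow p lf; pose M := #|A|.
have AtV t : t \in T -> t * g^-1 \in A.
  by move=> Tt; rewrite groupM ?groupV ?(subsetP sTA t).
have S1 t : t \in T -> (\sum_(0 <= j < M * p) f (t * g^-1)%g ^+ j =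
    (M * p)%:R * (f (t * g^-1)%g == 1)%:R)%R.
  move=> Tt; rewrite sum_powers; first by case: eqP; rewrite ?mulr1 ?mulr0.
  by rewrite exprM lchar_order ?AtV // expr1n.
have S2 t : t \in T -> (\sum_(0 <= j < M * p | (p %| j)%N) f (t * g^-1)%g ^+ j =
    M%:R * (f (t * g^-1)%g ^+ p == 1)%:R)%R.
  move=> Tt; rewrite sum_multiples //.
  rewrite (eq_bigr (fun i => (f (t * g^-1)%g ^+ p) ^+ i)%R) => [|i _]; last first.
    by rewrite mulnC exprM.
  rewrite sum_powers; first by case: eqP; rewrite ?mulr1 ?mulr0.
  by rewrite -exprM mulnC exprM lchar_order ?AtV // expr1n.
have E : (\sum_(t in T) \sum_(0 <= j < M * p) f (t * g^-1)%g ^+ j =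
  \sum_(t in T) \sum_(0 <= j < M * p | (p %| j)%N) f (t * g^-1)%g ^+ j)%R.
  rewrite exchange_big [RHS]exchange_big /= [RHS]big_mkcond.
  apply: eq_bigr => j _; case: ifP => // /negbT; rewrite -prime_coprime // => cpj.
  case: (lf) => _ fM.
  rewrite (eq_bigr (fun t => f t ^+ j * f g^-1%g ^+ j)%R) => [|t Tt].
    by rewrite -mulr_suml vT ?mul0r // coprime_sym.
  by rewrite fM ?groupV ?exprMn // (subsetP sTA).
rewrite (eq_bigr _ S1) (eq_bigr _ S2) -!mulr_sumr sum_chker // in E.
rewrite (sum_chker lfp) // in E.
move/eqP: E; rewrite -!natrM eqr_nat -mulnA eqn_pmul2l ?cardG_gt0 //.
by move/eqP.
Qed.

Hypothesis abelA : abelian A.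

(** By Tijdeman's theorem the [j]-th powers of [Om] also tile with [T]. The sums of [f] over these
    two factors multiply to its sum over [A], which is 0, while the one over [T] is not. *)
Lemma tile_vanish (p : nat) f g Om T : p.-group A -> lchar f -> g \in A ->
    f g != 1%R -> tile A Om T -> (\sum_(t in T) f t != 0)%R ->
  vanish p f Om.
Proof.
move=> pA lf Ag fg1 tOT fT0 j cjp.
have cOj: coprime #|Om| j.
  apply: (@coprime_dvdl _ #|A|); first by rewrite -(tile_card tOT) dvdn_mulr.
  by have [k ->] := p_natP pA; rewrite coprimeXl // coprime_sym.
have tj := tijdeman abelA cOj tOT; have [sOA _] := tile_sub tOT.
have := tile_lchar lf tj; rewrite (lchar_sum0 lf Ag fg1) => /eqP.
rewrite mulf_eq0 (negPf fT0) orbF big_imset => [/eqP s0 | ] /=; last first.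
  by apply/imset_injP; rewrite (tile_card_eq tOT tj).
by apply: etrans s0; apply: eq_bigr => w Ow; rewrite lcharX // (subsetP sOA).
Qed.

Lemma chker_exp_coprime f j (p : nat) : p.-group A -> lchar f -> coprime j p ->
  chker (fun x => f x ^+ j)%R = chker f.
Proof.
move=> pA lf cjp; apply/setP=> x; rewrite !mem_chker.
have [Ax|] //= := boolP (x \in A); apply/eqP/eqP => [fxj|->]; last first.
  by rewrite expr1n.
have cAj: coprime #|A| j.
  by have [k ->] := p_natP pA; rewrite coprimeXl // coprime_sym.
by rewrite -[x](expgK cAj) // lcharX ?groupX // lcharX // fxj expr1n.
Qed.

(** If the sums of all [f ^ j] over [T] with [j] prime to [p] vanish, [T] is uniform. Otherwise some
    [f ^ j] has nonzero sum and makes every complement uniform over its kernels, which are those of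
    [f] and [f ^ p]. *)
Lemma uniform_dichotomy (p : nat) f g T : prime p -> p.-group A -> lchar f ->
    g \in A -> f g != 1%R -> T \subset A ->
  uniform p T (chker f) (chker (fun x => f x ^+ p)%R) \/
  (forall Om, tile A Om T ->
     uniform p Om (chker f) (chker (fun x => f x ^+ p)%R)).
Proof.
move=> p_pr pA lf Ag fg1 sTA.
pose fT j := (\sum_(t in T) f t ^+ j)%R.
(* Both the sum and coprimality to [p] depend only on [j] modulo [#|A| * p], so a finite search
   decides. *)
have [/existsP[j /andP[cjp fTj]] | noj] :=
  boolP [exists j : 'I_(#|A| * p), coprime j p && (fT j != 0%R)]; last first.
  left; apply: vanish_uniform => // j cjp; apply/eqP/negPn/negP=> fTj.
  case/existsP: noj; have n0: 0 < #|A| * p by rewrite muln_gt0 cardG_gt0 prime_gt0.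
  exists (Ordinal (ltn_pmod j n0)) => /=; apply/andP; split.
    by rewrite -coprime_modl modn_dvdm ?dvdn_mull // coprime_modl.
  congr (_ != _): fTj; apply: eq_bigr => t Tt.
  rewrite {1}(divn_eq j (#|A| * p)) exprD mulnCA exprM.
  by rewrite lchar_order ?(subsetP sTA) // expr1n mul1r.
right=> Om tOT; have [sOA _] := tile_sub tOT.
have lfj := lchar_pow j lf.
have fgj: (f g ^+ j != 1)%R.
  have: g \notin chker (fun x => f x ^+ j)%R.
    by rewrite (chker_exp_coprime pA lf cjp) mem_chker Ag.
  by rewrite mem_chker Ag.
have:= vanish_uniform p_pr lfj sOA (tile_vanish pA lfj Ag fgj tOT fTj).
rewrite (chker_exp_coprime pA lf cjp).
suffices -> : chker (fun x => (f x ^+ j) ^+ p)%R = chker (fun x => f x ^+ p)%R by [].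
rewrite -(chker_exp_coprime pA (lchar_pow p lf) cjp).
by apply/setP=> x; rewrite !mem_chker exprAC.
Qed.

Lemma lchar_irr (i : Iirr A) : lchar ('chi_i)%R.
Proof.
have lin := char_abelianP _ abelA i.
by split; [apply: lin_char1 | apply: lin_charM].
Qed.

Lemma fourier_inversion T g : T \subset A -> g \in A ->
  (\sum_(i : Iirr A) (\sum_(t in T) 'chi_i t) * ('chi_i g)^* =
   #|A|%:R *+ (g \in T))%R.
Proof.
move=> sTA Ag.
rewrite (eq_bigr (fun i : Iirr A => \sum_(t in T) 'chi_i t * ('chi_i g)^*)%R); last first.
  by move=> i _; rewrite mulr_suml.
rewrite exchange_big /=.
have classA : g ^: A = [set g] by apply/cent_classP; rewrite (subsetP abelA).
have centA x : x \in A -> 'C_A[x] = A.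
  move=> Ax; apply/setIidPl; apply: subset_trans abelA _.
  by rewrite -cent_set1 centS // sub1set.
rewrite (eq_bigr (fun t => #|A|%:R *+ (t == g))%R) => [|t Tt]; last first.
  rewrite second_orthogonality_relation // centA ?(subsetP sTA) //.
  by rewrite classA inE.
have [Tg|nTg] := boolP (g \in T); last first.
  by rewrite big1 // => t Tt; case: eqP nTg => // <-; rewrite Tt.
rewrite (bigD1 g) //= eqxx big1 ?addr0 // => t /andP[_ /negPf->].
by [].
Qed.

(** In the inversion formula, passing from [t] to [t * e] leaves the terms with [chi e = 1]
    unchanged, and the other terms are 0. *)
Lemma irr_vanish_period T e : T \subset A -> e \in A ->
    (forall i : Iirr A, ('chi_i e != 1)%R -> (\sum_(t in T) 'chi_i t = 0)%R) ->
  T :* e = T.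
Proof.
move=> sTA Ae van; apply/eqP; rewrite eqEcard card_rcoset leqnn andbT.
apply/subsetP=> _ /rcosetP[t Tt ->]; have At := subsetP sTA t Tt.
have: (#|A|%:R *+ ((t * e)%g \in T) = #|A|%:R *+ (t \in T) :> algC)%R.
  rewrite -!fourier_inversion ?groupM //; apply: eq_bigr => i _.
  have [e1|/van->] := eqVneq ('chi_i e)%R 1%R; last by rewrite !mul0r.
  by case: (lchar_irr i) => _ ->; rewrite // e1 mulr1.
rewrite Tt; case: (_ \in T) => // /eqP.
by rewrite mulr0n mulr1n eq_sym (negPf (neq0CG A)).
Qed.

Lemma irr_not_vanish T e : T \subset A -> e \in A -> T :* e != T ->
  exists i : Iirr A, ('chi_i e != 1)%R /\ (\sum_(t in T) 'chi_i t != 0)%R.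
Proof.
move=> sTA Ae Te; have [/existsP[i /andP[]] | no] := boolP
  [exists i : Iirr A, (('chi_i e != 1)%R) && (\sum_(t in T) 'chi_i t != 0)%R].
  by exists i.
case/eqP: Te; apply: irr_vanish_period => // i ei; apply/eqP/negPn/negP=> Ti.
by case/existsP: no; exists i; rewrite ei.
Qed.

(** The quotient of a point outside [T] by a point of [T] is not a period of [T]. *)
Lemma irr_not_const T : T \subset A -> T != set0 -> T != A ->
  exists (i : Iirr A) (e : gT),
    [/\ e \in A, ('chi_i e != 1)%R & (\sum_(t in T) 'chi_i t != 0)%R].
Proof.
move=> sTA /set0Pn[t Tt] TA; have At := subsetP sTA t Tt.
have [a Aa Ta]: exists2 a, a \in A & a \notin T.
  apply/subsetPn; apply: contra TA => sAT; by rewrite eqEsubset sTA.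
have Ae: t^-1 * a \in A by rewrite groupM ?groupV.
have [|i [ei Ti]] := irr_not_vanish sTA Ae; last by exists i, (t^-1 * a).
apply: contraNneq Ta => <-; rewrite mem_rcoset invMg invgK.
by rewrite mulKVg.
Qed.

End Characters.

(** * Chains of subgroups *)

Section Chains.

Variables (gT : finGroupType) (A : {group gT}) (p : nat).
Implicit Types (Om T : {set gT}) (K : nat -> {group gT}) (J : pred nat).
Hypotheses (abelA : abelian A) (p_gt0 : 0 < p).

Lemma card_fibres (T : {set gT}) (f : gT -> gT) (Y : {set gT}) :
  (forall t, t \in T -> f t \in Y) ->
  #|T| = \sum_(y in Y) #|[set t in T | f t == y]|.
Proof.
move=> fT; rewrite -sum1_card (partition_big f (mem Y)) //=.
by apply: eq_bigr => y Yy; rewrite -sum1_card; apply: eq_bigl => t; rewrite inE.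
Qed.

(** At a level in [J] the count over the larger coset is [p] times one over the smaller coset. At
    any other level the larger coset is a union of smaller ones, and divisibility passes to the
    sum. *)
Lemma chain_dvdn K J a T :
    (forall i, i < a -> K i \subset K i.+1) ->
    (forall i, i <= a -> K i \subset A) -> T \subset A ->
    (forall i, i < a -> J i -> uniform A p T (K i) (K i.+1)) ->
  forall g, g \in A -> p ^ (\sum_(i < a) J i) %| #|T :&: K a :* g|.
Proof.
move=> sK sKA sTA; elim: a sK sKA => [|a IHa] sK sKA uJ g Ag.
  by rewrite big_ord0 dvd1n.
have {}IHa := IHa (fun i lt => sK i (ltnW lt)) (fun i le => sKA i (leqW le))
                  (fun i lt => uJ i (ltnW lt)).
rewrite big_ord_recr /=; case: (boolP (J a)) => Ja.
  by rewrite -(uJ a (ltnSn a) Ja g Ag) addn1 expnS dvdn_pmul2l ?IHa.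
rewrite addn0; pose f t := repr (K a :* t).
set S := T :&: _.
rewrite (@card_fibres S f [set f t | t in S]) => [|t St]; last exact: imset_f.
apply: dvdn_sum => _ /imsetP[t St ->].
have [Tt Kt] := setIP St; have At := subsetP sTA t Tt.
suffices -> : [set s in S | f s == f t] = T :&: K a :* t by apply: IHa.
apply/setP=> s; rewrite !inE -andbA; congr (_ && _).
have ff u : f u \in K a :* u by apply: mem_repr_rcoset.
apply/andP/idP => [[_ /eqP fst] | st].
  have := ff s; rewrite fst => /rcoset_eqP E.
  by rewrite -(rcoset_eqP (ff t)) E rcoset_refl.
split; last by rewrite /f (rcoset_eqP st).
rewrite -(rcoset_eqP Kt); move: st; rewrite !mem_rcoset.
exact/(subsetP (sK a (ltnSn a))).
Qed.

(** [T'] is carved out of [A] down the chain: a level in [J] changes nothing; at any other level one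
    coset of the smaller subgroup is kept in each coset of the larger, which divides the count by
    [p]. The choice depends on the chain and [J] alone, so one [T'] serves every [Om] uniform
    outside [J]. *)
Lemma chain_complement K J a :
    (forall i, i < a -> K i \subset K i.+1) -> K a = A :> {set gT} ->
  exists T' : {set gT}, [/\ T' \subset A, T' != set0,
    forall h, h \in K 0 -> T' :* h = T' &
    forall Om, Om \subset A ->
      (forall i, i < a -> ~~ J i -> uniform A p Om (K i) (K i.+1)) ->
    forall g, g \in A ->
      (p ^ (\sum_(i < a) ~~ J i) * #|[set w in Om | (w^-1 * g)%g \in T']| = #|Om|)%N].
Proof.
elim: a K J => [|a IHa] K J sK Ka.
  exists A; split=> // [|h|Om sOA _ g Ag].
  - by apply/set0Pn; exists 1; apply: group1.
  - by rewrite -Ka => Kh; apply: rcoset_id; rewrite Ka in Kh *.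
  rewrite big_ord0 mul1n; apply: eq_card => w; rewrite inE.
  by apply: andb_idr => Ow; rewrite groupM ?groupV ?(subsetP sOA w).
have [T1 [sT1 nzT1 KT1 cT1]] :=
  IHa (fun i => K i.+1) (fun i => J i.+1) (fun i lt => sK i.+1 lt) Ka.
have sK01 : K 0 \subset K 1%N by apply: sK.
have [J0 | J0] := boolP (J 0).
  exists T1; split=> // [h /(subsetP sK01)|Om sOA uJ g Ag]; first exact: KT1.
  by rewrite big_ord_recl J0 add0n cT1 // => i lti Ji; apply: uJ.
have sK1A : K 1%N \subset A.
  rewrite -Ka; elim: {IHa KT1 cT1} a {Ka} sK => // a IHa sK.
  apply: subset_trans (sK a.+1 (ltnSn _)); apply: IHa => i lti.
  exact/sK/ltnW.
have memK1 h t : h \in K 1%N -> t \in T1 -> h * t \in T1.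
  move=> Kh Tt; rewrite -(KT1 h Kh) mem_rcoset.
  have At := subsetP sT1 t Tt.
  by rewrite (memAC abelA (subsetP sK1A h Kh) At) mulgK.
pose f x := repr (K 1%N :* x).
have ff x : f x \in K 1%N :* x by apply: mem_repr_rcoset.
(* [T1] is a union of cosets of [K 1]; in each, only the coset of [K 0] through the chosen
   representative is kept. *)
pose T' := [set x in T1 | x * (f x)^-1 \in K 0].
pose Y := f @: T1.
have fT1 x : x \in T1 -> f x \in T1.
  move=> Tx; have /rcosetP[k Kk ->] := ff x; exact: memK1.
have ffx x : f (f x) = f x by rewrite {1}/f (rcoset_eqP (ff x)).
exists T'; split.
- by apply/subsetP=> x /setIdP[/(subsetP sT1)].
- have [x Tx] := set0Pn _ nzT1; apply/set0Pn; exists (f x).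
  by rewrite inE fT1 // ffx mulgV group1.
- move=> h Kh; apply/eqP; rewrite eqEcard card_rcoset leqnn andbT.
  apply/subsetP=> _ /rcosetP[x /setIdP[Tx K0x] ->].
  have K1h := subsetP sK01 h Kh.
  have xhC : x * h = h * x.
    by apply: (memAC abelA (subsetP sT1 x Tx)); apply: (subsetP sK1A).
  have fxh : f (x * h) = f x.
    by rewrite /f xhC rcosetM rcoset_id.
  by rewrite inE fxh xhC memK1 //= -mulgA groupM.
move=> Om sOA uJ g Ag; rewrite big_ord_recl J0 add1n expnSr -mulnA.
rewrite -[RHS](cT1 _ sOA _ g Ag) => [|i lti Ji]; last exact: uJ.
congr (_ * _)%N.
have cosetE (B : {group gT}) w y : w \in A -> y \in A ->
    (w^-1 * g \in B :* y) = (w \in B :* (g * y^-1)).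
  move=> Aw Ay; rewrite !mem_rcoset -groupV !invMg !invgK.
  by rewrite mulgA (memAC abelA _ Aw) // groupM ?groupV.
(* Sorting [w] by the representative [y] of the coset of [w^-1 * g] turns the condition into
   membership in a coset of [g * y^-1], where uniformity of [Om] applies. *)
have fibre (B : {group gT}) (S : {set gT}) :
    (forall x y, y \in Y -> (x \in S) && (f x == y) = (x \in B :* y)) ->
    (forall x, x \in S -> x \in T1) ->
  #|[set w in Om | w^-1 * g \in S]| = \sum_(y in Y) #|Om :&: B :* (g * y^-1)|.
  move=> SB sS; rewrite (@card_fibres _ (fun w => f (w^-1 * g)) Y); last first.
    by move=> w; rewrite inE => /andP[_ /sS]; apply: imset_f.
  apply: eq_bigr => y Yy; apply: eq_card => w; rewrite !inE -andbA SB //.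
  apply: andb_id2l => Ow; apply: cosetE; first exact: (subsetP sOA).
  by have /imsetP[x Tx ->] := Yy; apply/(subsetP sT1)/fT1.
rewrite (fibre (K 0)) => [|x y /imsetP[x0 Tx0 ->]|x /setIdP[]] //; last first.
  rewrite inE -andbA; apply/and3P/idP => [[_ Kx /eqP<-]|Kx].
    by rewrite mem_rcoset.
  have K1x : x \in K 1%N :* f x0.
    by move: Kx; rewrite !mem_rcoset => /(subsetP sK01).
  have -> : f x = f x0 by rewrite -[RHS]ffx /f (rcoset_eqP K1x).
  split=> //; last by rewrite -mem_rcoset.
  have /rcosetP[k Kk ->] := K1x; apply: memK1 => //; exact: fT1.
rewrite (fibre (K 1%N)) => [|x y /imsetP[x0 Tx0 ->]|x] //; last first.
  apply/andP/idP => [[_ /eqP<-]|Kx].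
    by rewrite (rcoset_eqP (ff x)) rcoset_refl.
  split; first by have /rcosetP[k Kk ->] := Kx; apply: memK1 => //; exact: fT1.
  by rewrite -[f x0]ffx /f (rcoset_eqP Kx).
rewrite big_distrr /=; apply: eq_bigr => y /imsetP[x Tx ->].
by apply: uJ => //; rewrite groupM ?groupV ?(subsetP sT1 (f x)) ?fT1.
Qed.

End Chains.

(** * Simultaneous periodic complements *)

(** The period or the periodic set is chosen before [Om], because one choice must later serve all
    slices of a complement. *)
Definition replaceable (gT : finGroupType) (A T : {set gT}) : Prop :=
  (exists2 h, h \in A^# & forall Om, tile A Om T -> Om :* h = Om) \/
  (exists2 T', periodic A T' & forall Om, tile A Om T -> tile A Om T').

Section Replaceable.

Variables (gT : finGroupType) (A : {group gT}).
Implicit Types (Om T : {set gT}) (x y g : gT) (K : {group gT}).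
Hypotheses (abelA : abelian A) (ntA : A != 1 :> {set gT}).

Lemma replaceable_vacuous T :
  (forall Om, ~~ tile A Om T) -> replaceable A T.
Proof.
move=> no; left; have [h Ah h1] := trivgPn A ntA.
by exists h => [|Om tOT]; [rewrite !inE h1 | case/negP: (no Om)].
Qed.

Lemma replaceable_tiled T :
  (forall Om, tile A Om T -> replaceable A T) -> replaceable A T.
Proof.
move=> rT; have [/existsP[Om] | no] := boolP [exists Om, tile A Om T].
  exact: rT.
apply: replaceable_vacuous => Om; apply: contra no => tOT.
by apply/existsP; exists Om.
Qed.

Lemma replaceable_period T h : h \in A^# -> T :* h = T -> replaceable A T.
Proof.
move=> Ah Th; apply: replaceable_tiled => Om tOT; right; exists T => //.
split; last by exists h.
by have /andP[_] := tile_card_gt0 tOT; rewrite card_gt0.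
Qed.

Lemma replaceable_card1 T : #|T| = 1%N -> replaceable A T.
Proof.
move=> T1; left; have [h Ah h1] := trivgPn A ntA.
exists h => [|Om tOT]; first by rewrite !inE h1.
have [sOA _] := tile_sub tOT.
suffices -> : Om = A by apply: rcoset_id.
by apply/eqP; rewrite eqEcard sOA -(tile_card tOT) T1 muln1 leqnn.
Qed.

Lemma replaceable_full T : T \subset A -> #|T| = #|A| -> replaceable A T.
Proof.
move=> sTA cT; have [h Ah h1] := trivgPn A ntA.
apply: (@replaceable_period T h); first by rewrite !inE h1.
suffices -> : T = A by apply: rcoset_id.
by apply/eqP; rewrite eqEcard sTA cT leqnn.
Qed.

Lemma periodic_group K : K \subset A -> K != 1 :> {set gT} -> periodic A K.
Proof.
move=> sKA /trivgPn[h Kh h1]; split; first by apply/set0Pn; exists 1.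
by exists h; [rewrite !inE h1 (subsetP sKA) | apply: rcoset_id].
Qed.

Lemma tile_group Om K : Om \subset A -> K \subset A ->
  (forall g, g \in A -> #|Om :&: K :* g| = 1%N) -> tile A Om K.
Proof.
move=> sOA sKA cnt; apply: tile_of_count => // g Ag.
rewrite -[RHS](cnt g Ag); apply: eq_card => w; rewrite !inE.
apply: andb_id2l => Ow; rewrite mem_rcoset -groupV invMg invgK.
by rewrite (memAC abelA) ?groupV // (subsetP sOA).
Qed.

(** Let [d = w^-1 * w']. Unless [d = 1], the translates of [T] by [w] and [w * d] partition [A], so
    [d] exchanges [T] with its set complement and [d ^+ 2] preserves [T]. *)
Lemma pair_period Om T w w' : tile A Om T -> Om = [set w; w'] ->
  T :* (w^-1 * w') ^+ 2 = T.
Proof.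
move=> tOT defO; have [sOA sTA] := tile_sub tOT.
have [Ow Ow'] : w \in Om /\ w' \in Om by rewrite defO !inE !eqxx orbT.
have [Aw Aw'] := (subsetP sOA w Ow, subsetP sOA w' Ow').
set d := w^-1 * w'; have Ad : d \in A by rewrite groupM ?groupV.
have defw' : w' = w * d by rewrite mulKVg.
have [ww'|nww'] := eqVneq w w'.
  by rewrite /d -ww' mulVg expg1n mulg1.
have tdE t : t \in A -> w * (t * d) = w' * t.
  by move=> At; rewrite (memAC abelA At Ad) mulgA mulKVg.
have step t : t \in T -> t * d \notin T.
  move=> Tt; apply: contraNN nww' => Ttd; apply/eqP.
  by have [] := tile_uniq tOT Ow Ow' Ttd Tt (tdE t (subsetP sTA t Tt)).
have step' t : t \in A -> t \notin T -> t * d \in T.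
  move=> At nTt; have [|v [s [Ov Ts]]] := @tile_mem _ _ _ _ (w' * t) tOT.
    exact: groupM.
  move: Ov; rewrite defO => /set2P[] ->; first by rewrite -tdE // => /mulgI->.
  by move/mulgI=> ts; rewrite ts Ts in nTt.
apply/eqP; rewrite eqEcard card_rcoset leqnn andbT.
apply/subsetP=> _ /rcosetP[t Tt ->]; have At := subsetP sTA t Tt.
by rewrite (expgS d 1) expg1 mulgA; apply: step'; [apply: groupM | apply: step].
Qed.

Lemma cards2_set (B : {set gT}) : #|B| = 2 -> exists w w', B = [set w; w'].
Proof. by move/eqP/cards2P=> [w [w' [_ ->]]]; exists w, w'. Qed.

(** With [T = {t, t d}], either [d ^+ 2] is a nontrivial period of every complement, or [d] is an
    involution and a period of [T]. *)
Lemma replaceable_card2 T : T \subset A -> #|T| = 2 -> replaceable A T.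
Proof.
move=> sTA /cards2_set[t [t' defT]].
have [At At'] : t \in A /\ t' \in A.
  by split; apply: (subsetP sTA); rewrite defT !inE eqxx ?orbT.
set d := t^-1 * t'; have Ad : d \in A by rewrite groupM ?groupV.
have [d2|d2] := eqVneq (d ^+ 2) 1; last first.
  left; exists (d ^+ 2) => [|Om tOT]; first by rewrite !inE d2 groupX.
  by move: tOT; rewrite tileC // => /pair_period; apply.
have [d1|d1] := eqVneq d 1.
  apply: replaceable_card1; rewrite defT (_ : t' = t) ?setUid ?cards1 //.
  by rewrite -[t'](mulKVg t) -/d d1 mulg1.
apply: (@replaceable_period T d); first by rewrite !inE d1.
have t'E : t' = t * d by rewrite mulKVg.
apply/eqP; rewrite eqEcard card_rcoset leqnn andbT defT.
apply/subsetP=> _ /rcosetP[x /set2P[]-> ->]; rewrite !inE.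
  by rewrite -t'E eqxx orbT.
by rewrite t'E -mulgA -(expgS d 1) d2 mulg1 eqxx.
Qed.

(* With [a = y / x] an involution and [b = z / x], every quotient of two
   elements of [T'] is, up to inversion, one of [a], [b] and [b / a = z / y]. *)
Lemma replaceable_card4 T x y : T \subset A -> #|T| = 4 -> x \in T -> y \in T ->
  x != y -> x ^+ 2 = y ^+ 2 -> replaceable A T.
Proof.
move=> sTA T4 Tx Ty nxy xy2; have [Ax Ay] := (subsetP sTA x Tx, subsetP sTA y Ty).
have [z Tz /norP[nzx nzy]] : exists2 z, z \in T & ~~ ((z == x) || (z == y)).
  have /subsetPn[z Tz] : ~~ (T \subset [set x; y]).
    by apply: contraL (eqxx 4) => /subset_leq_card; rewrite T4 cards2 nxy.
  by rewrite !inE => nz; exists z.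
have Az := subsetP sTA z Tz.
pose a := x^-1 * y; pose b := x^-1 * z.
have Aa : a \in A by rewrite groupM ?groupV.
have Ab : b \in A by rewrite groupM ?groupV.
have a1 : a != 1.
  by apply: contraNneq nxy => a1; rewrite -[y](mulKVg x) -/a a1 mulg1.
have b1 : b != 1.
  by apply: contraNneq nzx => b1; rewrite -[z](mulKVg x) -/b b1 mulg1.
have ba : b != a.
  by apply: contraNneq nzy => ba; rewrite -[y](mulKVg x) -/a -ba mulKVg.
have a2 : a * a = 1.
  rewrite -(expgS a 1) expgMn ?expgVn ?xy2 ?mulVg //.
  by apply: (memAC abelA); rewrite ?groupV.
(* The union of the cosets of [{1, a}] through [1] and [b], hence of period [a]. *)
pose T' := [set 1; a; b; a * b].
have ab1 : a * b != 1.
  by apply: contraNneq ba => ab1; rewrite -[b]mul1g -a2 -mulgA ab1 mulg1.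
have sT'A : T' \subset A.
  by rewrite /T' !subUset !sub1set group1 Aa Ab groupM.
have T'4 : #|T'| = 4.
  rewrite /T' setUC cardsU1 [[set 1; a] :|: _]setUC cardsU1 cards2 !inE.
  have aba : a * b != a by apply: contraNneq b1 => aba; rewrite -(mulKg a b) aba mulVg.
  have abb : a * b != b by apply: contraNneq a1 => abb; rewrite -(mulgK b a) abb mulgV.
  by rewrite (negPf aba) (negPf abb) (negPf ab1) (negPf b1) (negPf ba) eq_sym a1.
right; exists T'.
  split; first by apply/set0Pn; exists 1; rewrite !inE eqxx.
  exists a; first by rewrite !inE a1.
  apply/eqP; rewrite eqEcard card_rcoset leqnn andbT.
  apply/subsetP=> _ /rcosetP[u + ->]; rewrite !inE -!orbA.
  case/or4P=> /eqP->; rewrite ?mul1g ?a2 ?eqxx ?orbT //.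
    by rewrite (memAC abelA Ab Aa) eqxx !orbT.
  by rewrite -mulgA (memAC abelA Ab Aa) mulgA a2 mul1g eqxx !orbT.
move=> Om tOT; have [sOA _] := tile_sub tOT.
have memO w : w \in Om -> w \in A by apply: subsetP.
apply: tile_of_inj => // [|w w' u u' Ow Ow' T'u T'u' E].
  by rewrite T'4 -T4 (tile_card tOT).
have [Aw Aw'] := (memO w Ow, memO w' Ow').
have no s t v v' : s \in T -> t \in T -> v \in Om -> v' \in Om ->
    v = v' * (s^-1 * t) -> s = t.
  move=> Ts Tt Ov Ov' Ev; have [As At] := (subsetP sTA s Ts, subsetP sTA t Tt).
  have [|//] := tile_uniq tOT Ov Ov' Ts Tt; rewrite Ev -mulgA.
  by rewrite (memAC abelA _ As) ?groupM ?groupV // mulKVg.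
have noa v v' : v \in Om -> v' \in Om -> v != v' * a.
  by move=> Ov Ov'; apply: contraNneq nxy => /no->.
have nob v v' : v \in Om -> v' \in Om -> v != v' * b.
  by move=> Ov Ov'; apply: contraNneq nzx => /no->.
have noab v v' : v \in Om -> v' \in Om -> v != v' * (a * b).
  move=> Ov Ov'; apply: contraNneq nzy => Ev.
  have aV : a = y^-1 * x.
    by rewrite -[LHS]mulg1 -[1](mulgV a) mulgA a2 mul1g invMg invgK.
  by apply/eqP/esym/(no y z v v') => //; rewrite Ev aV /b -mulgA mulKVg.
have Cab := memAC abelA Aa Ab.
move: T'u T'u' E; rewrite !inE -!orbA.
have aK v : v * a * a = v by rewrite -mulgA a2 mulg1.
have symE v v' : v * a = v' * b -> v = v' * (a * b).
  by move=> Ev; rewrite Cab (mulgA v') -Ev aK.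
have symE' v v' : v * a = v' * (a * b) -> v = v' * b.
  by rewrite Cab (mulgA v') => /mulIg.
have symE'' v v' : v * b = v' * (a * b) -> v = v' * a.
  by rewrite (mulgA v') => /mulIg.
(* The four diagonal cases are immediate; the other twelve contradict [noa], [nob] or [noab]. *)
do 2![case/or4P=> /eqP->] => //; rewrite ?mulg1 => E.
- by case/eqP: (noa _ _ Ow Ow').
- by case/eqP: (nob _ _ Ow Ow').
- by case/eqP: (noab _ _ Ow Ow').
- by case/eqP: (noa _ _ Ow' Ow).
- by case/eqP: (noab _ _ Ow Ow'); apply: symE.
- by case/eqP: (nob _ _ Ow Ow'); apply: symE'.
- by case/eqP: (nob _ _ Ow' Ow).
- by case/eqP: (noab _ _ Ow' Ow); apply: symE.
- by case/eqP: (noa _ _ Ow Ow'); apply: symE''.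
- by case/eqP: (noab _ _ Ow' Ow).
- by case/eqP: (nob _ _ Ow' Ow); apply: symE'.
by case/eqP: (noa _ _ Ow' Ow); apply: symE''.
Qed.

End Replaceable.

(** * Elementary abelian groups: factors of order [p], and factors with complements of order [p] or
    4 *)

Section Elementary.

Variables (gT : finGroupType) (A : {group gT}).
Implicit Types (Om T : {set gT}) (x y g : gT) (K : {group gT}).
Hypotheses (abelA : abelian A) (ntA : A != 1 :> {set gT}).

Lemma abelem_expp p x : prime p -> p.-abelem A -> x \in A -> x ^+ p = 1.
Proof. by move=> p_pr /(abelemP p_pr)[_]; apply. Qed.

Lemma setI_rcosetA Om g : Om \subset A -> g \in A -> Om :&: A :* g = Om.
Proof. by move=> sOA Ag; rewrite rcoset_id //; apply/setIidPl. Qed.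

(* A factor of order p is transversal to any hyperplane over which [T] is not
   equidistributed. *)
Lemma replaceable_cocard_prime p T : prime p -> p.-abelem A -> T \subset A ->
  1 < #|T| -> #|A| = (p * #|T|)%N -> replaceable A T.
Proof.
move=> p_pr eA sTA T1 cA.
have T0 : T != set0 by rewrite -card_gt0 (ltnW T1).
have TA : T != A.
  apply/eqP=> TA; move: cA; rewrite -TA -{1}[#|T|]mul1n => /eqP.
  rewrite (eqn_pmul2r (ltnW T1)) => /eqP p1.
  by rewrite -p1 in p_pr.
have [i [e [Ae ie Ti]]] := irr_not_const abelA sTA T0 TA.
have lf := lchar_irr abelA i; set f := ('chi_i)%R in lf ie Ti.
have pA := abelem_pgroup eA.
(* In exponent [p] the kernel of [f ^ p] is all of [A], so uniformity puts [|Om| / p = 1] point of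
   [Om] in each coset of the kernel of [f]. *)
have kerp : chker A (fun x => f x ^+ p)%R = A.
  apply/setP=> x; rewrite mem_chker; apply: andb_idr => Ax.
  by rewrite -(lcharX _ lf) // abelem_expp //; case: lf => ->.
have tK Om : tile A Om T -> tile A Om (chker_group lf).
  move=> tOT; have [sOA _] := tile_sub tOT.
  have cO : #|Om| = p.
    by apply/eqP; rewrite -(eqn_pmul2r (ltnW T1)) (tile_card tOT) cA.
  apply: tile_group => //= [|g Ag]; first exact: chker_sub.
  have := vanish_uniform p_pr lf sOA (tile_vanish abelA pA lf Ae ie tOT Ti) Ag.
  rewrite kerp setI_rcosetA // cO => /eqP.
  by rewrite -{2}[p]muln1 eqn_pmul2l ?prime_gt0 // => /eqP.
apply: replaceable_tiled => // Om tOT; right; exists (chker_group lf) => //.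
apply: periodic_group; first exact: chker_sub.
rewrite -cardG_gt1; suffices -> : #|chker_group lf| = #|T| by [].
have /andP[O0 _] := tile_card_gt0 tOT.
by apply/eqP; rewrite -(eqn_pmul2l O0) (tile_card tOT) (tile_card (tK _ tOT)).
Qed.

(** [T] is replaced by the subgroup generated by a quotient [d = t1 / t2] of two of its points. A
    coincidence reads [w' = w * d ^+ k]; for [0 < k < p] the [k]-th powers of [T] tile with [Om],
    and [w * t1 ^+ k = w' * t2 ^+ k] forces [d ^+ k = 1]. *)
Lemma replaceable_card_prime p T : prime p -> p.-abelem A -> T \subset A ->
  #|T| = p -> replaceable A T.
Proof.
move=> p_pr eA sTA Tp.
have /card_gt1P[t1 [t2 [Tt1 Tt2 nt]]] : 1 < #|T| by rewrite Tp prime_gt1.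
have [At1 At2] := (subsetP sTA _ Tt1, subsetP sTA _ Tt2).
pose d := t1 * t2^-1; have Ad : d \in A by rewrite groupM ?groupV.
have d1 : d != 1.
  by apply: contraNneq nt => d1; rewrite -[t1](mulgKV t2) -/d d1 mul1g.
have od : #[d] = p.
  by apply: nt_prime_order => //; apply: abelem_expp.
right; exists <[d]>.
  by apply: periodic_group; rewrite ?cycle_subG //= cycle_eq1.
move=> Om tOT; have [sOA _] := tile_sub tOT.
apply: tile_of_inj => // [||w w' x y Ow Ow' Dx Dy E].
- by rewrite cycle_subG.
- by rewrite -orderE od -Tp (tile_card tOT).
have [Aw Aw'] := (subsetP sOA w Ow, subsetP sOA w' Ow').
have Dxy : x * y^-1 \in <[d]> by rewrite groupM ?groupV.
have /cyclePmin[k] := Dxy; rewrite od => ltkp dk.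
case: k => [|k] in ltkp dk.
  by apply/eqP; rewrite eq_mulgV1 dk expg0.
have ckp : coprime #|T| k.+1 by rewrite Tp prime_coprime // gtnNdvd.
have tTO : tile A [set t ^+ k.+1 | t in T] Om.
  by apply: tijdeman => //; rewrite tileC.
have dkE : d ^+ k.+1 = t1 ^+ k.+1 * t2 ^- k.+1.
  by rewrite expgMn ?expgVn //; apply: (memAC abelA); rewrite ?groupV.
have Ek : t1 ^+ k.+1 = t2 ^+ k.+1.
  have [|] := tile_uniq tTO (imset_f _ Tt1) (imset_f _ Tt2) Ow Ow'; last by [].
  have E' : w * (x * y^-1) = w' by rewrite mulgA E mulgK.
  rewrite [RHS](memAC abelA _ Aw') ?groupX // -E' dk dkE mulgA mulgKV.
  by apply: (memAC abelA); rewrite ?groupX.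
by apply/eqP; rewrite eq_mulgV1 dk dkE Ek mulgV.
Qed.

Lemma irr_nontrivial (i : Iirr A) : i != 0%R ->
  exists2 x, x \in A & ('chi_i x != 1)%R.
Proof.
move=> i0; have [/exists_inP //|no] := boolP [exists x in A, ('chi_i x != 1)%R].
case/eqP: i0; apply/eqP; rewrite -irr_eq1; apply/eqP/cfun_inP => x Ax.
by rewrite cfun1E Ax; apply/eqP/negPn; apply: (exists_inPn no).
Qed.

(* Let [S] be the Fourier transform of [1_T].  Since [1_T] is idempotent, the
   convolution of [S] with itself is [|A| S]; if no [psi] contributed to the convolution at
   [chi] besides [1] and [chi], this would read [2 |T| S chi = |A| S chi]. *)
Lemma irr_not_vanish_mul T (i : Iirr A) : T \subset A -> #|A| != (2 * #|T|)%N ->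
    (\sum_(t in T) 'chi_i t != 0)%R -> i != 0%R ->
  exists j : Iirr A, [/\ j != 0%R, j != i, (\sum_(t in T) 'chi_j t != 0)%R &
    (\sum_(t in T) 'chi_i t * ('chi_j t)^* != 0)%R].
Proof.
move=> sTA cA Si i0.
pose S j := (\sum_(t in T) 'chi[A]_j t)%R.
pose R j := (\sum_(t in T) 'chi_i t * ('chi[A]_j t)^*)%R.
have [/existsP[j /and4P[]] | no] := boolP
    [exists j, [&& j != 0%R, j != i, S j != 0%R & R j != 0%R]].
  by exists j.
have conv : (\sum_j S j * R j = #|A|%:R * S i)%R.
  rewrite (eq_bigr (fun j => \sum_(t in T) 'chi_i t * (S j * ('chi_j t)^*))%R);
    last by move=> j _; rewrite mulr_sumr; apply: eq_bigr => t _; rewrite mulrCA.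
  rewrite exchange_big /= mulr_sumr; apply: eq_bigr => t Tt.
  rewrite -mulr_sumr fourier_inversion ?(subsetP sTA t) // Tt mulrC.
  by rewrite mulr1n.
have S0 : (S 0 = #|T|%:R)%R.
  rewrite -sum1_card natr_sum; apply: eq_bigr => t Tt.
  by rewrite irr0 cfun1E (subsetP sTA t Tt).
have R0 : (R 0 = S i)%R.
  apply: eq_bigr => t Tt.
  by rewrite irr0 cfun1E (subsetP sTA t Tt) rmorph1 mulr1.
have Ri : (R i = #|T|%:R)%R.
  rewrite -sum1_card natr_sum; apply: eq_bigr => t Tt.
  have lin := char_abelianP _ abelA i; have At := subsetP sTA t Tt.
  by rewrite -(lin_charV_conj lin) // -(lin_charM lin) ?groupV // mulgV (lin_char1 lin).
move: conv; rewrite (bigD1 0%R) //= (bigD1 i) //= big1 => [|j /andP[j0 ji]].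
  rewrite S0 R0 Ri addr0 [(S i * _)%R]mulrC -mulrDl => /(mulIf Si)/eqP.
  by rewrite -natrD eqr_nat addnn -mul2n eq_sym (negPf cA).
apply/eqP; rewrite mulf_eq0; apply: contraNT no; rewrite negb_or => /andP[Sj Rj].
by apply/existsP; exists j; rewrite j0 ji Sj.
Qed.

(** There are characters [fi], [fj] such that the sums of [fi], [fj] and [fi fj] over [T] are
    nonzero; all three then sum to 0 over each complement. This puts exactly one of its four points
    in each coset of the common kernel. *)
Lemma replaceable_cocard4 T : 2.-abelem A -> T \subset A ->
  1 < #|T| -> #|A| = (4 * #|T|)%N -> replaceable A T.
Proof.
move=> eA sTA T1 cA; have T0 := ltnW T1.
have nT0 : T != set0 by rewrite -card_gt0.
have TA : T != A.
  apply/eqP=> TA; move: cA; rewrite -TA -{1}[#|T|]mul1n => /eqP.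
  by rewrite (eqn_pmul2r T0).
have [i [e [Ae ie Ti]]] := irr_not_const abelA sTA nT0 TA.
have i0 : i != 0%R.
  by apply: contraNneq ie => ->; rewrite irr0 cfun1E Ae.
have cA2 : #|A| != (2 * #|T|)%N by rewrite cA eqn_pmul2r.
have [j [j0 ji Tj Tij]] := irr_not_vanish_mul sTA cA2 Ti i0.
have sqr x : x \in A -> x * x = 1.
  by move=> Ax; rewrite -(expgS x 1) abelem_expp.
have lfi := lchar_irr abelA i; have lfj := lchar_irr abelA j.
set fi := ('chi_i)%R in lfi Ti Tij ie; set fj := ('chi_j)%R in lfj Tj Tij.
have conj_fj x : x \in A -> (fj x)^*%R = fj x.
  move=> Ax; rewrite -(lin_charV_conj (char_abelianP _ abelA j)) //.
  by congr (fj _); apply/eqP; rewrite eq_invg_mul sqr.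
have lf := lchar_mul lfi lfj.
have {}Tij : (\sum_(t in T) fi t * fj t != 0)%R.
  congr (_ != _): Tij; apply: eq_bigr => t Tt.
  by rewrite conj_fj ?(subsetP sTA).
have [x Ax jx] := irr_nontrivial j0; rewrite -/fj in jx.
have pm f y : lchar A f -> y \in A -> (f y == 1)%R || (f y == -1)%R.
  move=> lff Ay; rewrite -sqrf_eq1 -(lcharX _ lff) // abelem_expp //.
  by case: lff => ->.
have [y Ay ijy] : exists2 y, y \in A & (fi y * fj y != 1)%R.
  have [/exists_inP //|no] := boolP [exists y in A, (fi y * fj y != 1)%R].
  case/eqP: ji; apply/irr_inj/cfun_inP => y Ay.
  have := exists_inPn no y Ay; rewrite negbK -/fi -/fj.
  by case/orP: (pm _ _ lfi Ay) (pm _ _ lfj Ay) => /eqP-> /orP[]/eqP->;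
     rewrite ?mulr1 ?mul1r // => /eqP->.
have tK Om : tile A Om T -> tile A Om (chker_group lfi :&: chker_group lfj).
  move=> tOT; have [sOA _] := tile_sub tOT.
  have cO : #|Om| = 4.
    by apply/eqP; rewrite -(eqn_pmul2r T0) (tile_card tOT) cA.
  have van f z : lchar A f -> z \in A -> f z != 1%R ->
      (\sum_(t in T) f t != 0)%R -> (\sum_(w in Om) f w = 0)%R.
    move=> lff Az fz nT; have := tile_lchar lff tOT.
    by rewrite (lchar_sum0 lff Az fz) => /eqP; rewrite mulf_eq0 (negPf nT) orbF => /eqP.
  apply: tile_group => //= [|g Ag]; first by rewrite subIset ?chker_sub.
  have Ei w : w \in Om -> fi (w * g^-1) = (fi w * fi g^-1%g)%R.
    by move=> Ow; case: lfi => _ ->; rewrite ?groupV ?(subsetP sOA w).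
  have Ej w : w \in Om -> fj (w * g^-1) = (fj w * fj g^-1%g)%R.
    by move=> Ow; case: lfj => _ ->; rewrite ?groupV ?(subsetP sOA w).
  (* The product of [1 + fi] and [1 + fj] is 4 times the indicator of the common kernel; its sum
     over the shifted [Om] is computed in two ways. *)
  have s0 : (\sum_(w in Om) (1 + fi (w * g^-1)%g) * (1 + fj (w * g^-1)%g) = 4%:R)%R.
    transitivity (\sum_(w in Om) (1 + fi w * fi g^-1%g + fj w * fj g^-1%g
       + (fi w * fj w) * (fi g^-1%g * fj g^-1%g)))%R.
      by apply: eq_bigr => w Ow; rewrite Ei // Ej // mulrDl mul1r mulrDr mulr1 mulrACA addrA;
         congr (_ + _)%R; rewrite addrAC.
    rewrite !big_split /= -!mulr_suml (van _ _ lfi Ae ie Ti) (van _ _ lfj Ax jx Tj).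
    by rewrite (van _ _ lf Ay ijy Tij) !mul0r !addr0 sumr_const cO.
  have : (\sum_(w in Om) (1 + fi (w * g^-1)%g) * (1 + fj (w * g^-1)%g) =
          4%:R * #|Om :&: (chker A fi :&: chker A fj) :* g|%:R)%R.
    rewrite -sum1_card natr_sum mulr_sumr.
    rewrite (big_setID ((chker A fi :&: chker A fj) :* g)) /=.
    rewrite [X in (_ + X)%R]big1 => [|w /setDP[Ow]].
      rewrite addr0; apply: eq_bigr => w /setIP[_].
      rewrite mem_rcoset inE !mem_chker => /andP[/andP[_ /eqP->] /andP[_ /eqP->]].
      by rewrite mulr1 -[(1 + 1)%R]/(2%:R)%R -natrM.
    have Awg : w * g^-1 \in A by rewrite groupM ?groupV ?(subsetP sOA w).
    rewrite mem_rcoset inE !mem_chker Awg /=.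
    by case/orP: (pm _ _ lfi Awg) (pm _ _ lfj Awg) => /eqP-> /orP[]/eqP->;
       rewrite ?eqxx ?subrr ?mul0r ?mulr0.
  rewrite s0 -{1}[4%:R%R]mulr1 => /mulfI; rewrite pnatr_eq0 => /(_ isT)/eqP.
  by rewrite eq_sym pnatr_eq1 => /eqP.
apply: replaceable_tiled => // Om tOT; right.
exists (chker_group lfi :&: chker_group lfj); last exact: tK.
apply: periodic_group; first by rewrite subIset ?chker_sub.
rewrite -cardG_gt1; suffices -> : #|chker_group lfi :&: chker_group lfj| = #|T| by [].
have /andP[O0 _] := tile_card_gt0 tOT.
by apply/eqP; rewrite -(eqn_pmul2l O0) (tile_card tOT) (tile_card (tK _ tOT)).
Qed.

End Elementary.

(** * Translation of tilings, restriction to a subgroup and extension from it *)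

Lemma tile_translate (gT : finGroupType) (A : {group gT}) (Om T : {set gT}) a :
  abelian A -> a \in A -> tile A Om T -> tile A (Om :* a) T.
Proof.
move=> abelA Aa tOT; have [sOA sTA] := tile_sub tOT.
apply: tile_of_inj => // [||v v' t t' /rcosetP[w Ow ->] /rcosetP[w' Ow' ->]].
- by apply/subsetP=> _ /rcosetP[w Ow ->]; rewrite groupM ?(subsetP sOA w).
- by rewrite card_rcoset (tile_card tOT).
move=> Tt Tt'; have [At At'] := (subsetP sTA t Tt, subsetP sTA t' Tt').
rewrite -!mulgA (memAC abelA Aa At) (memAC abelA Aa At') !mulgA => /mulIg E.
by have [] := tile_uniq tOT Ow Ow' Tt Tt' E.
Qed.

Lemma tile_restrict (gT : finGroupType) (A E : {group gT}) (Om T : {set gT}) :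
  E \subset A -> Om \subset E -> tile A Om T -> tile E Om (T :&: E).
Proof.
move=> sEA sOE tOT; apply: tile_of_count => // [|g Eg]; first exact: subsetIr.
rewrite -[RHS](tile_count tOT (subsetP sEA g Eg)).
apply: eq_card => w; rewrite !inE; apply: andb_id2l => Ow.
by rewrite andbC groupM ?groupV ?(subsetP sOE w).
Qed.

(** Complements translated into [E] see only [T :&: E]. A replacement for it in [E] is multiplied by
    a transversal [R] of [E] in [A]. *)
Lemma replaceable_extend (gT : finGroupType) (A E : {group gT}) (T : {set gT}) :
    abelian A -> E \subset A -> T \subset A ->
    (forall Om, tile A Om T -> exists2 a, a \in A & Om :* a \subset E) ->
  replaceable E (T :&: E) -> replaceable A T.
Proof.
move=> abelA sEA sTA toE.
have tE Om : tile A Om T ->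
    exists2 a, a \in A & tile E (Om :* a) (T :&: E).
  move=> tOT; have [a Aa sOE] := toE Om tOT; exists a => //.
  exact/(tile_restrict sEA sOE)/tile_translate.
case=> [[h /setD1P[h1 Eh] perh] | [T0 [nzT0 [h /setD1P[h1 Eh] T0h]] tT0]].
  left; exists h => [|Om tOT]; first by rewrite !inE h1 (subsetP sEA).
  have [a Aa /perh] := tE _ tOT; have Ah := subsetP sEA h Eh.
  rewrite -rcosetM (memAC abelA Aa Ah) rcosetM => /(congr1 (fun B => B :* a^-1)).
  by rewrite -!rcosetM -!mulgA mulgV !mulg1.
pose R := repr @: rcosets E A.
have sRA : R \subset A.
  apply/subsetP=> _ /imsetP[_ /rcosetsP[x Ax ->] ->].
  have /rcosetP[k Ek ->] := mem_repr_rcoset E x.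
  by rewrite groupM ?(subsetP sEA k).
right; exists (T0 * R).
  have [t0 Tt0] := set0Pn _ nzT0.
  split.
    apply/set0Pn; exists (t0 * repr (E :* 1)); apply: mem_mulg => //.
    by apply/imset_f/rcosetsP; exists 1.
  have Ah := subsetP sEA h Eh; exists h; first by rewrite !inE h1.
  apply/eqP; rewrite eqEcard card_rcoset leqnn andbT.
  apply/subsetP=> _ /rcosetP[_ /mulsgP[t r Tt Rr ->] ->].
  rewrite -mulgA (memAC abelA (subsetP sRA r Rr) Ah) mulgA mem_mulg //.
  by rewrite -T0h mem_rcoset mulgK.
move=> Om tOT; have [a Aa ta] := tE Om tOT; have tOa := tT0 _ ta.
have [sOA _] := tile_sub tOT; have [sOE sTE] := tile_sub tOa.
suffices tl: tile A (Om :* a) (T0 * R).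
  have := tile_translate abelA (groupVr Aa) tl.
  by rewrite -rcosetM mulgV mulg1.
apply: tile_surj.
- exact: subset_trans sEA.
- by rewrite mul_subG // (subset_trans sTE).
- rewrite mulgA; case/and4P: tOa => _ _ /eqP-> _; apply/subsetP=> x Ax.
  have /rcosetP[k Ek Er] := mem_repr_rcoset E x.
  apply/mulsgP; exists k^-1 (repr (E :* x)); rewrite ?groupV //.
    by apply/imset_f/rcosetsP; exists x.
  by rewrite Er mulKg.
rewrite -(Lagrange sEA) -(tile_card tOa) -mulnA leq_mul2l; apply/orP; right.
apply: (@leq_trans (#|T0| * #|R|)).
  by rewrite mulg_imset -cardsX leq_imset_card.
by rewrite leq_mul2l leq_imset_card orbT.
Qed.

(** * Small elementary abelian groups, and abelian groups of order at most 16 with at most two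
    squares *)

Section SmallExponent.

Variables (gT : finGroupType) (A : {group gT}).
Implicit Types (Om T : {set gT}) (x y g : gT).

Lemma tile_card_pfactor p k Om T : prime p -> #|A| = (p ^ k)%N -> tile A Om T ->
  exists2 j, j <= k & #|T| = (p ^ j)%N.
Proof.
move=> p_pr cA tOT; have : #|T| %| p ^ k by rewrite -cA -(tile_card tOT) dvdn_mull.
by case/(dvdn_pfactor _ _ p_pr) => j lejk ->; exists j.
Qed.

(** Orders [1], [p], [|A| / p] and [|A|] of [T] exhaust the case [k <= 3]. For [p = 2] and [k <= 5]
    there remain [|T| = 4] and [|T| = 8] with [|A| = 32]. *)
Lemma replaceable_abelem p k T : prime p -> p.-abelem A -> A != 1 :> {set gT} ->
  #|A| = (p ^ k)%N -> (k <= 3) || (p == 2) && (k <= 5) -> T \subset A ->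
  replaceable A T.
Proof.
move=> p_pr eA ntA cA lek sTA; have abelA := abelem_abelian eA.
apply: replaceable_tiled => // Om tOT.
have [j lejk cT] := tile_card_pfactor p_pr cA tOT.
have [j0|j0] := posnP j; first by apply: replaceable_card1; rewrite // cT j0.
have T1 : 1 < #|T| by rewrite cT -{1}(expn0 p) ltn_exp2l ?prime_gt1.
have [jk|nejk] := eqVneq j k; first by apply: replaceable_full; rewrite ?cT ?jk.
have ltjk : j < k by rewrite ltn_neqAle nejk.
have [j1|nej1] := eqVneq j 1%N.
  by apply: (@replaceable_card_prime _ A abelA p); rewrite // cT j1.
have [jk1|nejk1] := eqVneq j.+1 k.
  by apply: (@replaceable_cocard_prime _ A abelA ntA p); rewrite // cA cT -jk1 expnS.
have ltjk1 : j.+1 < k by rewrite ltn_neqAle nejk1.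
case: (boolP (p == 2)) lek => [/eqP p2 | _]; last first.
  rewrite orbF => le3; have := leq_trans ltjk1 le3.
  by case: (j) j0 nej1 => [|[|]].
move=> lek; have {lek} le5 : k <= 5.
  by case/orP: lek => // le3; apply: leq_trans le3 _.
rewrite {}p2 in cT cA eA.
have [j2|nej2] := eqVneq j 2.
  have /card_gt1P[x [y [Tx Ty nxy]]] := T1.
  apply: (@replaceable_card4 _ A abelA T x y) => //; first by rewrite cT j2.
  by rewrite !(abelem_expp (isT : prime 2) eA) ?(subsetP sTA x) ?(subsetP sTA y).
apply: replaceable_cocard4 => //; rewrite cT cA.
have k5 : k = j.+2.
  have j3 : 2 < j by case: (j) j0 nej1 nej2 => [|[|[|]]].
  apply/eqP; rewrite eqn_leq ltjk1 andbT.
  by apply: leq_trans le5 _; rewrite !ltnS.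
by rewrite k5 !expnS mulnA.
Qed.

(** If [|T| = 4], two points of [T] have equal squares. If [|T| = 8] and [|A| = 16], complements are
    pairs: either the quotient of some pair has a nontrivial square, which is a period of [T], or
    every pair has a translate inside the subgroup [E] of elements of square 1. *)
Lemma replaceable_squares k s T : abelian A -> A != 1 :> {set gT} ->
  #|A| = (2 ^ k)%N -> k <= 4 -> {in A, forall x, x ^+ 2 = 1 \/ x ^+ 2 = s} ->
  T \subset A -> replaceable A T.
Proof.
move=> abelA ntA cA le4 sqA sTA.
apply: replaceable_tiled => // Om0 tOT0.
have [j lejk cT] := tile_card_pfactor (isT : prime 2) cA tOT0.
have [jk|nejk] := eqVneq j k; first by apply: replaceable_full; rewrite ?cT ?jk.
have ltj4 : j < 4 by apply: leq_trans le4; rewrite ltn_neqAle nejk.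
case: j => [|[|[|[|//]]]] in cT lejk nejk ltj4.
- exact: replaceable_card1.
- exact: replaceable_card2.
- have [x [y [Tx Ty nxy xy2]]] :
      exists x y, [/\ x \in T, y \in T, x != y & x ^+ 2 = y ^+ 2].
    have ninj : ~~ (#|[set x ^+ 2 | x in T]| == #|T|).
      rewrite cT neq_ltn; apply/orP; left; apply: (@leq_ltn_trans #|[set 1; s]|).
        apply/subset_leq_card/subsetP=> _ /imsetP[x Tx ->]; rewrite !inE.
        by case: (sqA x (subsetP sTA x Tx)) => ->; rewrite eqxx ?orbT.
      by rewrite cards2; case: (_ != _).
    have [/existsP[x /existsP[y /and4P[? ? ? /eqP ?]]]|no] :=
      boolP [exists x, exists y, [&& x \in T, y \in T, x != y & x ^+ 2 == y ^+ 2]].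
      by exists x, y.
    case/imset_injP: ninj => x y Tx Ty xy2; apply/eqP; apply: contraNT no => nxy.
    by apply/existsP; exists x; apply/existsP; exists y; rewrite Tx Ty nxy xy2 eqxx.
  exact: (@replaceable_card4 _ A abelA T x y).
have k4 : k = 4 by apply/eqP; rewrite eqn_leq le4 ltn_neqAle nejk.
rewrite k4 in cA.
have cO Om : tile A Om T -> exists w w', Om = [set w; w'].
  move=> tOT; apply: cards2_set; apply/eqP.
  by rewrite -(eqn_pmul2r (_ : 0 < 8)) // -[8]cT (tile_card tOT) cA cT.
have [/existsP[w /existsP[w' /andP[tww d2]]] | no] :=
  boolP [exists w, exists w', tile A [set w; w'] T && ((w^-1 * w') ^+ 2 != 1)].
  have [sOA _] := tile_sub tww; move: sOA; rewrite subUset !sub1set => /andP[Aw Aw'].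
  apply: (@replaceable_period _ A ntA T ((w^-1 * w') ^+ 2)).
    by rewrite !inE d2 groupX ?groupM ?groupV.
  exact: (pair_period abelA tww).
have E_set : group_set [set x in A | x ^+ 2 == 1].
  apply/group_setP; split=> [|x y]; first by rewrite inE group1 expg1n eqxx.
  rewrite !inE => /andP[Ax /eqP x2] /andP[Ay /eqP y2]; rewrite groupM //=.
  by rewrite expgMn ?x2 ?y2 ?mulg1 //; apply: (memAC abelA).
pose E := Group E_set.
have sEA : E \subset A by apply/subsetP=> x /setIdP[].
(* Squaring is a homomorphism with at most two values, so its kernel [E] has index at most 2. *)
have leE : 8 <= #|E|.
  rewrite -(leq_pmul2l (_ : 0 < 2)) // -[(2 * 8)%N]cA.
  have [sAE|/subsetPn[g Ag nEg]] := boolP (A \subset E).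
    by apply: leq_trans (subset_leq_card sAE) _; rewrite leq_pmull.
  have sA : A \subset E :|: E :* g.
    apply/subsetP=> x Ax; rewrite in_setU mem_rcoset.
    have [//|nEx] := boolP (x \in E); rewrite /= inE groupM ?groupV //=.
    rewrite expgMn; last by apply: (memAC abelA); rewrite ?groupV.
    have sq y : y \in A -> y \notin E -> y ^+ 2 = s.
      by move=> Ay; rewrite inE Ay /=; case: (sqA y Ay) => // ->; rewrite eqxx.
    by rewrite expgVn !sq // mulgV.
  apply: leq_trans (subset_leq_card sA) _; apply: leq_trans (leq_card_setU _ _) _.
  by rewrite card_rcoset addnn -mul2n.
have eE : 2.-abelem E.
  apply/abelemP => //; split=> [|x]; first exact: abelianS abelA.
  by rewrite inE => /andP[_ /eqP].
have toE Om : tile A Om T -> exists2 a, a \in A & Om :* a \subset E.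
  move=> tOT; have [w [w' defO]] := cO Om tOT; rewrite {Om}defO in tOT *.
  have [sOA _] := tile_sub tOT; move: sOA; rewrite subUset !sub1set => /andP[Aw Aw'].
  exists w^-1; first by rewrite groupV.
  apply/subsetP=> _ /rcosetP[v /set2P[]-> ->]; first by rewrite mulgV group1.
  rewrite (memAC abelA) ?groupV // inE groupM ?groupV //=.
  apply: contraNT no => d2; apply/existsP; exists w; apply/existsP; exists w'.
  by rewrite tOT.
apply: (replaceable_extend abelA sEA sTA toE).
have [a Aa sOE] := toE _ tOT0.
have cE : #|E| = (2 * #|T :&: E|)%N.
  rewrite -(tile_card (tile_restrict sEA sOE (tile_translate abelA Aa tOT0))).
  rewrite card_rcoset; congr (_ * _)%N; apply/eqP.
  by rewrite -(eqn_pmul2r (_ : 0 < 8)) // -[8]cT (tile_card tOT0) cA cT.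
apply: (@replaceable_cocard_prime _ E (abelianS sEA abelA) _ 2) => //.
- by rewrite -cardG_gt1 (leq_trans _ leE).
- exact: subsetIr.
by rewrite -(ltn_pmul2l (_ : 0 < 2)) // -cE (leq_trans _ leE).
Qed.

End SmallExponent.

(** * Abelian [p]-groups of order at most [p] times the exponent, whose nontrivial [p]-th powers all
    have [e] among their powers *)

Section CyclicByPrime.

Variables (gT : finGroupType) (A : {group gT}) (p a : nat) (e : gT).
Implicit Types (Om T : {set gT}) (x y g : gT).
Hypotheses (abelA : abelian A) (p_pr : prime p) (pA : p.-group A).
Hypotheses (Ae : e \in A^#) (minA : {in A, forall x, x ^+ p != 1 -> e \in <[x ^+ p]>}).
Hypotheses (expA : exponent A = (p ^ a)%N) (cardA : #|A| <= p ^ a.+1).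

(** If [x ^+ (p ^ i)] is nontrivial, [e] is a power of it, so [f] cannot be 1 there. Above the
    bottom level the kernel is thus independent of [f]. *)
Lemma chker_exp_p f i : lchar A f -> f e != 1%R -> 0 < i ->
  chker A (fun x => f x ^+ (p ^ i))%R = [set x in A | x ^+ (p ^ i) == 1].
Proof.
move=> lf fe i0; apply/setP=> x; rewrite mem_chker inE.
have [Ax|] //= := boolP (x \in A); rewrite -(lcharX _ lf) //.
apply/eqP/eqP=> [fx|->]; last by case: lf.
apply: contraNeq fe => nx; have Ay : x ^+ (p ^ i.-1) \in A by apply: groupX.
have Ey : (x ^+ (p ^ i.-1)) ^+ p = x ^+ (p ^ i).
  by rewrite -expgM mulnC -expnS prednK.
have := minA Ay; rewrite Ey => /(_ nx)/cycleP[k ->].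
by rewrite (lcharX _ lf) ?groupX // fx expr1n.
Qed.

(** A faithful [f] embeds [A] into the [p ^ a]-th roots of unity. *)
Lemma chker_small f : lchar A f -> (forall x, x \in A -> f x ^+ (p ^ a) = 1)%R ->
  chker A f = 1 -> #|A| <= p ^ a.
Proof.
move=> lf fa ker1; rewrite cardE -(size_map f).
have pa0 : 0 < p ^ a by rewrite expn_gt0 prime_gt0.
apply: (max_unity_roots pa0).
  apply/allP=> _ /mapP[x + ->]; rewrite mem_enum => Ax.
  by apply/unity_rootP; apply: fa.
rewrite map_inj_in_uniq ?enum_uniq // => x y; rewrite !mem_enum => Ax Ay fxy.
have : x * y^-1 \in chker A f.
  rewrite mem_chker groupM ?groupV //=; case: (lf) => _ ->; rewrite ?groupV //.
  by rewrite fxy (lcharV lf) // mulfV ?(lchar_neq0 lf).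
by rewrite ker1 => /set1P/eqP; rewrite -eq_mulgV1 => /eqP.
Qed.

(* Both [f0] and [f1] are characters of maximal order: [f0] does not vanish on
   [T], so every complement of [T] is uniform over its kernel, whereas [T] is
   uniform over the kernel of [f1].  The two filtrations by the kernels of the
   [p ^ i]-th powers differ only in their bottom term. *)
Lemma replaceable_cyclic_by_prime T : T \subset A -> replaceable A T.
Proof.
move=> sTA; have [e1 Ae'] := setD1P Ae.
have ntA : A != 1 :> {set gT} by apply/trivgPn; exists e.
have [Te|nTe] := eqVneq (T :* e) T; first exact: (replaceable_period ntA Ae).
have [i0 [f0e f0T]] := irr_not_vanish abelA sTA Ae' nTe.
have lf0 := lchar_irr abelA i0; set f0 := ('chi_i0)%R in f0e f0T lf0.
have [/existsP[Om1 /andP[tOT1 nOe]]|no] :=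
  boolP [exists Om : {set gT}, tile A Om T && (Om :* e != Om)]; last first.
  left; exists e => // Om tOT; apply/eqP; apply: contraNT no => nOe.
  by apply/existsP; exists Om; rewrite tOT.
have [sOA1 _] := tile_sub tOT1.
have [i1 [f1e f1O]] := irr_not_vanish abelA sOA1 Ae' nOe.
have lf1 := lchar_irr abelA i1; set f1 := ('chi_i1)%R in f1e f1O lf1.
have p0 := prime_gt0 p_pr.
have a0 : 0 < a.
  by rewrite lt0n; apply: contra ntA => /eqP a0; rewrite trivg_exponent expA a0.
pose Km f (lf : lchar A f) i := chker_group (lchar_pow (p ^ i) lf).
have KmS f (lf : lchar A f) i :
    Km f lf i.+1 = chker A (fun x => (f x ^+ (p ^ i)) ^+ p)%R :> {set gT}.
  by apply/setP=> x; rewrite !mem_chker expnSr exprM.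
have sK f (lf : lchar A f) i : Km f lf i \subset Km f lf i.+1.
  apply/subsetP=> x; rewrite KmS !mem_chker => /andP[-> /eqP->].
  by rewrite expr1n /=.
have Ka f (lf : lchar A f) : Km f lf a = A :> {set gT}.
  apply/setP=> x; rewrite mem_chker; apply: andb_idr => Ax.
  by rewrite -(lcharX _ lf) // -expA expg_exponent //; case: (lf) => ->.
have K0 f (lf : lchar A f) : Km f lf 0 = chker A f :> {set gT}.
  by apply/setP=> x; rewrite !mem_chker expr1.
have K01 i : 0 < i -> Km f0 lf0 i = Km f1 lf1 i :> {set gT}.
  by move=> i_gt0; rewrite /= !chker_exp_p.
have unif0 Om : tile A Om T -> uniform A p Om (Km f0 lf0 0) (Km f0 lf0 1%N).
  move=> tOT; have [sOA _] := tile_sub tOT; rewrite KmS K0.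
  exact/(vanish_uniform p_pr lf0 sOA)/(tile_vanish abelA pA lf0 Ae' f0e tOT f0T).
have unif1 : uniform A p T (Km f1 lf1 0) (Km f1 lf1 1%N).
  rewrite KmS K0; apply: (vanish_uniform p_pr lf1 sTA).
  by apply: (tile_vanish abelA pA lf1 Ae' f1e _ f1O); rewrite tileC.
(* [T] is uniform at level [i]; where this fails, the dichotomy makes every complement uniform. *)
pose U i := [forall g in A,
  (p * #|T :&: Km f0 lf0 i :* g| == #|T :&: Km f0 lf0 i.+1 :* g|)%N].
have dich i Om : i < a -> ~~ U i -> tile A Om T ->
    uniform A p Om (Km f0 lf0 i) (Km f0 lf0 i.+1).
  move=> lti nUi tOT.
  have [g Ag fg] : exists2 g, g \in A & (f0 g ^+ (p ^ i) != 1)%R.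
    have [->|i_gt0] := posnP i; first by exists e; rewrite ?expr1.
    have [/exists_inP //|all1] := boolP [exists g in A, f0 g ^+ (p ^ i) != 1]%R.
    suffices : exponent A %| p ^ i by rewrite expA dvdn_Pexp2l ?prime_gt1 // leqNgt lti.
    apply/exponentP=> x Ax; apply/eqP.
    have := exists_inPn all1 x Ax; rewrite negbK => fx.
    by have := chker_exp_p lf0 f0e i_gt0; move/setP/(_ x); rewrite mem_chker !inE Ax fx.
  have := uniform_dichotomy abelA p_pr pA (lchar_pow (p ^ i) lf0) Ag fg sTA.
  rewrite -KmS => -[uT|]; last exact.
  by case/negP: nUi; apply/forall_inP=> h Ah; apply/eqP/uT.
(* Level 0 is left out, since there every complement is uniform by the choice of [f0]. *)
pose J i := (0 < i) && U i.
have [T' [sT' nzT' KT' cT']] :=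
  chain_complement p abelA J (fun i _ => sK f0 lf0 i) (Ka f0 lf0).
have uO Om : tile A Om T -> forall i, i < a -> ~~ J i ->
    uniform A p Om (Km f0 lf0 i) (Km f0 lf0 i.+1).
  move=> tOT i lti; rewrite negb_and -leqNgt leqn0.
  by have [-> _|_ /=] := eqVneq i 0; [apply: unif0 | move/dich; apply].
have A1 : 1 \in A := group1 A.
have sKA f (lf : lchar A f) i : i <= a -> Km f lf i \subset A by move=> _; apply: chker_sub.
have KaT f (lf : lchar A f) (B : {set gT}) : B \subset A -> B :&: Km f lf a :* 1 = B.
  by move=> sBA; rewrite mulg1 Ka; apply/setIidPl.
(* Level 0 counts twice, for [Om] through [f0] and for [T] through [f1], so the exponents add up to
   [a.+1]. As [#|A| <= p ^ a.+1], divisibility becomes equality. *)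
pose nO := \sum_(i < a) ~~ J i; pose nT := \sum_(i < a) ((i == 0 :> nat) || J i).
have dvO Om : tile A Om T -> p ^ nO %| #|Om|.
  move=> tOT; have [sOA _] := tile_sub tOT; rewrite -(KaT f0 lf0 Om) //.
  apply: (chain_dvdn p0 (J := fun i => ~~ J i)) A1 => // [i|i lti]; [exact: sKA|exact: uO].
have dvT : p ^ nT %| #|T|.
  rewrite -(KaT f1 lf1 T) //.
  apply: (chain_dvdn p0 (J := fun i => (i == 0) || J i)) A1 => // [i|i lti].
    exact: sKA.
  case: (posnP i) => [-> _|i_gt0]; first exact: unif1.
  rewrite /= => /andP[_ /forall_inP uT].
  by move=> g Ag; have := uT g Ag; rewrite !K01 // => /eqP.
have nOT : (nO + nT)%N = a.+1.
  rewrite /nO /nT -big_split /= (eq_bigr (fun i : 'I_a => 1 + (i == 0 :> nat))%N).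
    rewrite big_split /= sum1_card card_ord -addn1; congr (_ + _)%N.
    by case: (a) a0 => // b _; rewrite big_ord_recl big1.
  by move=> i _; rewrite /J; case: posnP => [->|]; case: (U i) => //=; case: (val i).
have cO Om : tile A Om T -> #|Om| = (p ^ nO)%N.
  move=> tOT; apply/eqP; rewrite eqn_dvd dvO // andbT.
  have /dvdnP[u Eu] := dvO Om tOT; have /dvdnP[v Ev] := dvT.
  move: (cardA); rewrite -(tile_card tOT) Eu Ev mulnACA -expnD nOT.
  have /andP[O0 T0] := tile_card_gt0 tOT.
  move: O0 T0; rewrite Eu Ev !muln_gt0 => /andP[u0 _] /andP[v0 _].
  rewrite -{2}[(p ^ a.+1)%N]mul1n leq_pmul2r ?expn_gt0 ?p0 //.
  move=> uv1; have le1 : u <= 1 by apply: leq_trans uv1; apply: leq_pmulr.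
  by have -> : u = 1%N; [apply/eqP; rewrite eqn_leq le1 | rewrite mul1n].
have tT' Om : tile A Om T -> tile A Om T'.
  move=> tOT; have [sOA _] := tile_sub tOT; apply: tile_of_count => // g Ag.
  have := cT' Om sOA (uO Om tOT) g Ag; rewrite (cO Om tOT) -/nO => /eqP.
  by rewrite -{2}[(p ^ nO)%N]muln1 eqn_pmul2l ?expn_gt0 ?p0 // => /eqP.
right; exists T' => //; split=> //.
(* [A] is too large for [f0] to be faithful, and the elements of its kernel preserve [T']. *)
have /trivgPn[h Kh h1] : Km f0 lf0 0 != 1 :> {set gT}.
  apply/eqP; rewrite K0 => ker1.
  have fa x : x \in A -> (f0 x ^+ (p ^ a) = 1)%R.
    by move=> Ax; rewrite -(lcharX _ lf0) // -expA expg_exponent //; case: (lf0) => ->.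
  have := chker_small lf0 fa ker1; rewrite leqNgt => /negP[].
  have dvA : p ^ a.+1 %| #|A|.
    by rewrite -(tile_card tOT1) -nOT expnD dvdn_mul ?dvO.
  by apply: leq_trans (dvdn_leq (cardG_gt0 A) dvA); rewrite ltn_exp2l ?prime_gt1.
exists h; last exact: KT'.
by rewrite !inE h1; have := subsetP (sKA f0 lf0 0 isT) h Kh.
Qed.

End CyclicByPrime.

(** * Reduction to the slices and examples *)

(** Each slice of [Om] along a coset of [H], shifted into [H], is a complement of [T] in [H]; what
    holds for all slices at once holds for [Om]. *)
Lemma replaceable_sub (gT : finGroupType) (A H : {group gT}) (T : {set gT}) :
    abelian A -> H \subset A -> T \subset H -> replaceable H T ->
  replaceable A T.
Proof.
move=> abelA sHA sTH rT.
have slice Om a : tile A Om T -> a \in A -> tile H ((Om :* a) :&: H) T.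
  move=> tOT Aa; apply: tile_of_count => // [|g Hg]; first exact: subsetIr.
  rewrite -[RHS](tile_count (tile_translate abelA Aa tOT) (subsetP sHA g Hg)).
  apply: eq_card => w; rewrite !inE -andbA; apply: andb_id2l => _.
  apply: andb_idl => /(subsetP sTH).
  by rewrite groupMr // groupV.
case: rT => [[h /setD1P[h1 Hh] perh] | [T' [nzT' [h /setD1P[h1 Hh] T'h]] tT']].
  have Ah := subsetP sHA h Hh; left; exists h => [|Om tOT]; first by rewrite !inE h1.
  have [sOA _] := tile_sub tOT.
  apply/eqP; rewrite eqEcard card_rcoset leqnn andbT.
  apply/subsetP=> _ /rcosetP[w Ow ->]; have Aw := subsetP sOA w Ow.
  (* The slice shifted by [w^-1] contains 1, hence [h], so [w * h] lies in [Om]. *)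
  have /perh E := slice Om w^-1 tOT (groupVr Aw).
  have : h \in ((Om :* w^-1) :&: H) :* h.
    by rewrite mem_rcoset mulgV inE group1 mem_rcoset invgK mul1g Ow.
  by rewrite E inE mem_rcoset invgK (memAC abelA Aw Ah) => /andP[].
right; exists T'.
  by split=> //; exists h; rewrite // !inE h1 (subsetP sHA).
move=> Om tOT; have [sOA _] := tile_sub tOT.
have [_ sT'H] := tile_sub (tT' _ (slice Om 1 tOT (group1 A))).
apply: tile_of_count => // [|g Ag]; first exact: subset_trans sHA.
(* Factorizations of [g] over [Om] are those of 1 over the slice shifted by [g^-1]. *)
have := tile_count (tT' _ (slice Om g^-1 tOT (groupVr Ag))) (group1 H).
rewrite -(card_rcoset _ g) => <-; apply: eq_card => w.
rewrite mem_rcoset !inE mem_rcoset invgK mulgKV mulg1 invMg invgK.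
have [Ow|//] := boolP (w \in Om); have Aw := subsetP sOA w Ow.
rewrite (memAC abelA (groupVr Aw) Ag) /=; apply/esym/andb_idl => /(subsetP sT'H).
by rewrite -groupV invMg invgK.
Qed.

Lemma PT_of_replaceable (gT : finGroupType) (A H : {group gT}) m :
    abelian A -> H \subset A -> {in A, forall x, x ^+ m \in H} ->
    (forall q, prime q -> q %| m -> ~~ (q ^ 2 %| #|A|)) ->
    (H != 1 :> {set gT} -> forall T : {set gT}, T \subset H -> replaceable H T) ->
  PT_property A.
Proof.
move=> abelA sHA AmH m_sqf rH.
have [A1|ntA] := eqVneq (A : {set gT}) 1; [by left | right].
move=> Om T /tiling_pairP tOT.
have [/hasP[q]|/hasPn dvO] := boolP (has (fun q => ~~ (q %| #|Om|)) (primes #|A|)).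
  rewrite mem_primes => /and3P[q_pr _ qA] qO; right.
  have [T' pT' tT'] := periodic_complement abelA q_pr qA qO tOT.
  by exists T' => //; apply/tiling_pairP.
have /andP[O0 T0] := tile_card_gt0 tOT.
(* Every prime divisor of [|A|] now divides [|Om|], so the square of a prime common to [|T|] and [m]
   would divide [|A|]. *)
have coTm : coprime #|T| m.
  rewrite /coprime eqn_leq gcdn_gt0 T0 andbT leqNgt; apply/negP=> gt1.
  have q_pr := pdiv_prime gt1; set q := pdiv _ in q_pr.
  have [qT qm] : q %| #|T| /\ q %| m.
    by split; apply: dvdn_trans (pdiv_dvd _) _; rewrite ?dvdn_gcdl ?dvdn_gcdr.
  case/negP: (m_sqf q q_pr qm); rewrite -(tile_card tOT) expnS expn1 dvdn_mul //.
  apply/negPn/dvO; rewrite mem_primes q_pr cardG_gt0 -(tile_card tOT).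
  by rewrite dvdn_mull.
have tTO : tile A T Om by rewrite tileC.
have := tijdeman abelA coTm tTO; rewrite tileC //.
set T1 := [set _ | _ in T] => tT1.
have [sOA sTA] := tile_sub tOT.
have sT1H : T1 \subset H.
  by apply/subsetP=> _ /imsetP[t Tt ->]; apply/AmH/(subsetP sTA).
have rT1 : replaceable A T1.
  have [H1|/rH rH'] := eqVneq (H : {set gT}) 1; last first.
    by apply: replaceable_sub sHA sT1H (rH' _ sT1H).
  apply: replaceable_card1 => //; apply/eqP.
  have /andP[_ T10] := tile_card_gt0 tT1; rewrite eqn_leq T10 andbT.
  by rewrite -(cards1 (1 : gT)) -[[set _]]H1 subset_leq_card.
case: rT1 => [[h Ah perh] | [T' pT' tT']].
  by left; split; [rewrite -card_gt0 | exists h; rewrite ?perh].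
by right; exists T' => //; apply/tiling_pairP/tT'.
Qed.

(** * Groups isomorphic to a subgroup of a model group *)

Section Transfer.

Variables (hT gT : finGroupType) (L : {group hT}) (H : {group gT}).
Hypotheses (isoLH : L \isog H) (ntH : H != 1 :> {set gT}).

Lemma replaceable_isog_abelem p k (T : {set gT}) : prime p -> p.-abelem [set: hT] ->
    #|hT| = (p ^ k)%N -> (k <= 3) || (p == 2) && (k <= 5) -> T \subset H ->
  replaceable H T.
Proof.
move=> p_pr eD cD lek sTH.
have eH : p.-abelem H by rewrite -(isog_abelem isoLH) (abelemS (subsetT L)).
have : #|H| %| p ^ k by rewrite -cD -(card_isog isoLH) -cardsT cardSg ?subsetT.
case/(dvdn_pfactor _ _ p_pr) => j lejk cH.
apply: (@replaceable_abelem _ H p j) => //.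
case/orP: lek => [le3|/andP[-> le5]].
  by rewrite (leq_trans lejk le3).
by rewrite (leq_trans lejk le5) orbT.
Qed.

Lemma replaceable_isog_squares (s : hT) (T : {set gT}) : abelian [set: hT] -> #|hT| = 16 ->
    (forall x : hT, x ^+ 2 = 1 \/ x ^+ 2 = s) -> T \subset H ->
  replaceable H T.
Proof.
move=> abelD cD sqD sTH; have abelL := abelianS (subsetT L) abelD.
have : #|H| %| 2 ^ 4 by rewrite -[(2 ^ 4)%N]cD -(card_isog isoLH) -cardsT cardSg ?subsetT.
case/(dvdn_pfactor _ _ (isT : prime 2)) => j lej4 cH.
have /isogP[f injf imf] := isoLH.
apply: (@replaceable_squares _ H j (f s)) => //.
  by rewrite -(isog_abelian isoLH).
move=> x; rewrite -imf => /morphimP[y _ Ly ->].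
by rewrite -morphX //; case: (sqD y) => ->; [left; rewrite morph1 | right].
Qed.

(** [L :&: C] is cyclic, so its order is at most the exponent of [L], and it has index at most [p]
    in [L]. It contains all [p]-th powers of [L], and its only subgroup of order [p], if any of
    these is nontrivial, provides [e]. *)
Lemma replaceable_isog_cyclic_by_prime p (C : {group hT}) (T : {set gT}) :
    prime p -> p.-group [set: hT] -> abelian [set: hT] -> cyclic C ->
    #|hT| = (p * #|C|)%N -> (forall x : hT, x ^+ p \in C) -> T \subset H ->
  replaceable H T.
Proof.
move=> p_pr pD abelD cycC cD powC sTH.
have pL : p.-group L := pgroupS (subsetT L) pD.
have [a expL] : exists a, exponent L = (p ^ a)%N.
  have /(dvdn_pfactor _ _ p_pr)[a _ ->] : exponent L %| p ^ logn p #|L|.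
    by rewrite -(card_pgroup pL) exponent_dvdn.
  by exists a.
have cycX : cyclic (L :&: C) := cyclicS (subsetIr L C) cycC.
have leL : #|L| <= p ^ a.+1.
  have leX : #|L :&: C| <= p ^ a.
    rewrite -(exponent_cyclic cycX) -expL dvdn_leq ?exponent_gt0 //.
    exact/exponentS/subsetIl.
  apply: (@leq_trans (p * #|L :&: C|)); last by rewrite expnS leq_mul2l leX orbT.
  rewrite -(leq_pmul2r (cardG_gt0 C)) mul_cardG mulnAC -cD leq_mul2r.
  by rewrite -cardsT subset_leq_card ?orbT ?subsetT.
have ntL : L != 1 :> {set hT} by rewrite (isog_eq1 isoLH).
have subX x : x \in L -> <[x ^+ p]> \subset L :&: C.
  by move=> Lx; rewrite cycle_subG inE groupX ?powC.
have ordp x : x \in L -> x ^+ p != 1 -> exists2 e, e \in <[x ^+ p]> & #[e] = p.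
  move=> Lx xp.
  have pX : p.-group <[x ^+ p]> by apply: pgroupS pL; rewrite cycle_subG groupX.
  have ntX : <[x ^+ p]> != 1 by rewrite cycle_eq1.
  have [_ pdvX _] := pgroup_pdiv pX ntX.
  by have [e Xe oe] := Cauchy p_pr pdvX; exists e.
have [e Le mine] : exists2 e, e \in L^# &
    {in L, forall x, x ^+ p != 1 -> e \in <[x ^+ p]>}.
  (* If all [p]-th powers in [L] are trivial, any nontrivial [e] will do. *)
  have [/exists_inP[y Ly yp]|no] := boolP [exists y in L, y ^+ p != 1]; last first.
    have [e Le e1] := trivgPn L ntL; exists e; first by rewrite !inE e1.
    by move=> x Lx; rewrite (negPf (exists_inPn no x Lx)).
  have [e ey oe] := ordp y Ly yp; exists e.
    rewrite !inE -order_gt1 oe prime_gt1 //=.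
    by have /setIP[] := subsetP (subX y Ly) e ey.
  move=> x Lx xp; have [e' ex oe'] := ordp x Lx xp.
  suffices Ee : <[e']> = <[e]> by rewrite -cycle_subG -Ee cycle_subG.
  apply/eqP; rewrite (eq_subG_cyclic cycX) ?cycle_subG -?orderE ?oe ?oe' //.
    exact: subsetP (subX x Lx) _ ex.
  exact: subsetP (subX y Ly) _ ey.
have /isogP[f injf imf] := isoLH.
have [e1 Le'] := setD1P Le.
apply: (@replaceable_cyclic_by_prime _ H p a (f e)) => //.
- by rewrite -(isog_abelian isoLH) (abelianS (subsetT L)).
- by rewrite /pgroup -(card_isog isoLH).
- by rewrite !inE morph_injm_eq1 // e1 -imf mem_morphim.
- move=> x; rewrite -imf => /morphimP[y _ Ly ->].
  rewrite -morphX // morph_injm_eq1 ?groupX // => yp.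
  by rewrite -morphim_cycle ?groupX // mem_morphim // mine.
- by rewrite -(exponent_isog isoLH).
by rewrite -(card_isog isoLH).
Qed.

End Transfer.

(** * The four model groups *)

Lemma row_abelem q k : prime q -> q.-abelem [set: 'rV['Z_q]_k].
Proof.
move=> q_pr; apply/abelemP => //; split=> [|x _]; first exact: zmod_abelian.
rewrite zmodXgE; apply/rowP=> i.
by rewrite mulmxnE mxE -mulr_natr pchar_Zp ?mulr0 ?prime_gt1.
Qed.

Lemma card_row q k : prime q -> #|{: 'rV['Z_q]_k}| = (q ^ k)%N.
Proof. by move=> q_pr; rewrite card_mx mul1n card_ord Zp_cast ?prime_gt1. Qed.

Lemma expg_card_Zp q (x : 'Z_q) : 1 < q -> x ^+ q = 1.
Proof. by move=> q1; rewrite zmodXgE -mulr_natr pchar_Zp ?mulr0. Qed.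

Lemma abelian_setX (aT bT : finGroupType) (B : {set aT}) (C : {set bT}) :
  abelian B -> abelian C -> abelian (setX B C).
Proof.
move=> /centsP abB /centsP abC; apply/centsP=> -[x1 x2] /setXP[Bx Cx] [y1 y2].
by case/setXP=> By Cy; congr (_, _); [apply: abB | apply: abC].
Qed.

Lemma abelian_pair_zmod (U V : finZmodType) : abelian [set: U * V].
Proof.
have -> : [set: U * V] = setX setT setT by apply/setP=> x; rewrite !inE.
by apply: abelian_setX; apply: zmod_abelian.
Qed.

Lemma pair_expg (aT bT : finGroupType) (x : aT * bT) k :
  x ^+ k = (x.1 ^+ k, x.2 ^+ k).
Proof.
elim: k => [|k IHk]; first by rewrite !expg0.
by rewrite !expgS IHk.
Qed.

Lemma replaceable_isog_ZpnZp p n (gT : finGroupType) (H : {group gT})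
    (L : {group 'Z_(p ^ n) * 'Z_p}) (T : {set gT}) :
    prime p -> 0 < n -> L \isog H -> H != 1 :> {set gT} -> T \subset H ->
  replaceable H T.
Proof.
move=> p_pr n0 isoLH ntH; have p1 := prime_gt1 p_pr.
have pn1 : 1 < p ^ n by rewrite -(exp1n n) ltn_exp2r.
pose C := setX_group [set: 'Z_(p ^ n)] (one_group 'Z_p).
have cD : #|{: 'Z_(p ^ n) * 'Z_p}| = (p * #|C|)%N.
  by rewrite card_prod cardsX cards1 cardsT !card_ord !Zp_cast // muln1 mulnC.
apply: (@replaceable_isog_cyclic_by_prime _ _ L H isoLH ntH p C) => //.
- by rewrite /pgroup cardsT cD cardsX cards1 cardsT card_ord Zp_cast // muln1
    -expnS pnatX pnat_id.
- exact: abelian_pair_zmod.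
- by rewrite -(isog_cyclic (isog_setX1 _ _)) /= Zp_cycle cycle_cyclic.
by move=> x; rewrite pair_expg !inE /= expg_card_Zp.
Qed.

Lemma replaceable_isog_Z4Z2Z2 (gT : finGroupType) (H : {group gT})
    (L : {group 'Z_4 * 'rV['Z_2]_2}) (T : {set gT}) :
    L \isog H -> H != 1 :> {set gT} -> T \subset H -> replaceable H T.
Proof.
move=> isoLH ntH.
(* Doubling in this group yields only 0 and [(2, 0)]. *)
apply: (@replaceable_isog_squares _ _ L H isoLH ntH (2%:R, 0)%R).
- exact: abelian_pair_zmod.
- by rewrite card_prod card_ord card_row.
move=> x; rewrite pair_expg.
have -> : x.2 ^+ 2 = 1.
  by apply: (abelem_expp _ (row_abelem 2 _)); rewrite ?inE.
case: x.1 => [[|[|[|[|//]]]] ltx]; [left | right | left | right];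
  by congr (_, _); apply/val_inj.
Qed.

(* The cyclic group of order m is Zp m, a subgroup of 'Z_m; it is the whole of
   'Z_m when 1 < m, and is trivial when m = 1 (where 'Z_1 has two elements). *)
Theorem theorem1p3 (p n : nat) (gT : finGroupType) (G : {group gT}) (m : nat)
    (p_prime : prime p) (n_gt0 : 0 < n)
    (GsubH : [\/ isog_to_subgroup G 'rV['Z_2]_5,
                 isog_to_subgroup G 'rV['Z_p]_3,
                 isog_to_subgroup G ('Z_(p ^ n) * 'Z_p)%type
               | isog_to_subgroup G ('Z_4 * 'rV['Z_2]_2)%type])
    (m_gt0 : 0 < m) (m_sqfree : square_free m) (coGm : coprime #|G| m) :
  PT_property (setX G (Zp m)).
Proof.
pose A := setX_group G (Zp_group m).
pose H := setX_group G (one_group 'Z_m).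
have isoGH : G \isog H by apply: isog_setX1.
have abelG : abelian G.
  by case: GsubH => -[L /isog_abelian->]; apply: abelianS (subsetT L) _;
     [apply: zmod_abelian | apply: zmod_abelian
     | apply: abelian_pair_zmod | apply: abelian_pair_zmod].
apply: (@PT_of_replaceable _ A H m).
- by apply: abelian_setX => //; apply: zmod_abelian.
- by apply: setXS; rewrite ?sub1G.
- move=> [x z] /setXP[Gx Zz]; rewrite pair_expg !inE /= groupX //=.
  by rewrite -[m in _ ^+ m](card_Zp m_gt0) expg_cardG.
(* [q ^ 2] is prime to [|G|], so it would divide the square-free [m]. *)
- move=> q q_pr qm; rewrite cardsX card_Zp //; apply/negP.
  rewrite Gauss_dvdr => [/m_sqfree q1|]; first by rewrite q1 in q_pr.
  by rewrite coprime_sym coprimeXr // (coprime_dvdr qm).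
move=> ntH T sTH; case: GsubH => -[L isoGL];
  have isoLH : L \isog H by apply: isog_trans (isog_symr isoGL) isoGH.
- by apply: (replaceable_isog_abelem isoLH ntH (p := 2) (k := 5)) sTH;
    rewrite ?row_abelem ?card_row.
- by apply: (replaceable_isog_abelem isoLH ntH (p := p) (k := 3)) sTH;
    rewrite ?row_abelem ?card_row.
- exact: replaceable_isog_ZpnZp isoLH ntH sTH.
exact: replaceable_isog_Z4Z2Z2 isoLH ntH sTH.
Qed.
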